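(* Let $\mathcal{X}$ be a separable, completely metrizable, locally convex $\mathbb{R}$-vector space and $\mathcal{X}^{+}\subseteq\mathcal{X}$ a convex cone. Assume that for every $0$-neighborhood $\mathcal{U}$ there are $A_1,A_2\in\mathcal{X}$ and a $0$-neighborhood $\tilde{\mathcal{U}}$ with $\tilde{\mathcal{U}}\subseteq[A_1,A_2]\subseteq\mathcal{U}$, and that some $0$-neighborhood in $\mathcal{X}$ satisfies the infinite-dimensionality condition. Then $\mathcal{D}^{+}$ is a dense $G_\delta$ subset of $\mathbf{CU}(\mathcal{X}^{\ast,+})$ in the weak*-Hausdorff hypertopology.
   Context: $\mathcal{X}^{\ast}$ is the topological dual with the weak* topology. A convex cone $\mathcal{X}^+$ satisfies $\lambda A\in\mathcal{X}^+$, $A+B\in\mathcal{X}^+$ for $\lambda>0$, $A,B\in\mathcal{X}^+$; $A\preceq B$ iff $B-A\in\mathcal{X}^+$; $[A_1,A_2]=\{A:A_1\preceq A\preceq A_2\}$. $\mathcal{X}^{\ast,+}=\{\sigma\in\mathcal{X}^{\ast}:\sigma(A)\ge0\ \forall A\in\mathcal{X}^+\}$. A $0$-neighborhood $\mathcal{U}$ satisfies the infinite-dimensionality condition if there is an infinite set $\{\sigma_n\}$ of linearly independent elements of $\mathcal{X}^{\ast}$ with $\sup_{A\in\mathcal{U}}|\sigma_n(A)|<\infty$ for every $n$. $\mathcal{U}^{\circ}=\{\sigma\in\mathcal{X}^{\ast}:|\sigma(A)|\le1\ \forall A\in\mathcal{U}\}$; $\mathbf{CU}_{\mathcal{U}}(\mathcal{X}^{\ast})$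 is the set of nonempty convex weak*-closed subsets of $\mathcal{U}^{\circ}$; $\mathbf{CU}(\mathcal{X}^{\ast,+})=\bigcup_{\mathcal{U}}\{U\in\mathbf{CU}_{\mathcal{U}}(\mathcal{X}^{\ast}):U\subseteq\mathcal{X}^{\ast,+}\}$ over all $0$-neighborhoods. $\mathcal{D}=\bigcup_{\mathcal{U}}\{U\in\mathbf{CU}_{\mathcal{U}}(\mathcal{X}^{\ast}):U=\overline{\mathcal{E}(U)}\}$, with $\mathcal{E}(U)$ the extreme points and weak*-closure, and $\mathcal{D}^+=\mathcal{D}\cap\mathbf{CU}(\mathcal{X}^{\ast,+})$. The weak*-Hausdorff hypertopology is generated by the extended pseudometrics $d_H^{(A)}(F,\tilde F)=\max\{\sup_{\sigma\in F}\inf_{\tilde\sigma\in\tilde F}|(\sigma-\tilde\sigma)(A)|,\ \sup_{\tilde\sigma\in\tilde F}\inf_{\sigma\in F}|(\sigma-\tilde\sigma)(A)|\}$, $A\in\mathcal{X}$. *)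

(* Defs.v *)
From HB Require Import structures.
From mathcomp Require Import all_boot all_order all_algebra.
From mathcomp Require Import all_classical all_reals all_analysis.
Set Implicit Arguments. Unset Strict Implicit. Unset Printing Implicit Defensive.
Import Order.TTheory GRing.Theory Num.Theory.
Import numFieldNormedType.Exports.
Local Open Scope classical_set_scope.
Local Open Scope ring_scope.

Section Defs.
Variables (R : realType) (X : tvsType R).

Definition separable_space : Prop :=
  exists D : set X, countable D /\ closure D = setT.

Definition completely_metrizable : Prop :=
  exists d : X -> X -> R,
    [/\ (forall x y, 0 <= d x y),
        (forall x y, d x y = 0 <-> x = y),
        (forall x y, d x y = d y x) /\
        (forall x y z, d x z <= d x y + d y z),
        (forall (x : X) (U : set X),
            nbhs x U <-> exists2 e : R, 0 < e & [set y | d x y < e] `<=` U) &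
        (forall u : nat -> X,
           (forall e : R, 0 < e -> exists N, forall m n, (N <= m)%N -> (N <= n)%N ->
               d (u m) (u n) < e) ->
           exists l : X, forall e : R, 0 < e -> exists N, forall n, (N <= n)%N ->
               d (u n) l < e)].

Definition convex_cone (P : set X) : Prop :=
  (forall (l : R) (A : X), 0 < l -> P A -> P (l *: A)) /\
  (forall A B, P A -> P B -> P (A + B)).

Definition order_interval (P : set X) (A1 A2 : X) : set X :=
  [set A | P (A - A1) /\ P (A2 - A)].

Definition lin_fun (s : X -> R) : Prop :=
  forall (a : R) (x y : X), s (a *: x + y) = a * s x + s y.

Definition dual : set (X -> R) := [set s | lin_fun s /\ continuous s].

Definition dual_pos (P : set X) : set (X -> R) :=
  [set s | dual s /\ forall A, P A -> 0 <= s A].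

Definition lin_indep_seq (s : nat -> (X -> R)) : Prop :=
  forall (n : nat) (c : nat -> R),
    (forall A : X, \sum_(i < n) c i * s i A = 0) -> forall i, (i < n)%N -> c i = 0.

Definition infinite_dim_cond (U : set X) : Prop :=
  exists s : nat -> (X -> R),
    [/\ (forall n, dual (s n)), lin_indep_seq s &
        forall n, exists M : R, forall A, U A -> `|s n A| <= M].

Definition polar (U : set X) : set (X -> R) :=
  [set s | dual s /\ forall A, U A -> `|s A| <= 1].

Definition wclosure (S : set (X -> R)) : set (X -> R) :=
  [set s | dual s /\
     forall (As : seq X) (e : R), 0 < e ->
       exists2 t, S t & forall A, A \in As -> `|t A - s A| < e].

Definition wclosed (S : set (X -> R)) : Prop :=
  S `<=` dual /\ wclosure S `<=` S.

Definition convex_fset (S : set (X -> R)) : Prop :=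
  forall s t (l : R), S s -> S t -> 0 <= l -> l <= 1 ->
    S (fun A => l * s A + (1 - l) * t A).

Definition CU_U (U : set X) : set (set (X -> R)) :=
  [set F | F !=set0 /\ convex_fset F /\ wclosed F /\ F `<=` polar U].

Definition CU_pos (P : set X) : set (set (X -> R)) :=
  [set F | exists2 U : set X, nbhs (0 : X) U & CU_U U F /\ F `<=` dual_pos P].

Definition extreme_points (F : set (X -> R)) : set (X -> R) :=
  [set s | F s /\
     forall s1 s2 (l : R), F s1 -> F s2 -> 0 < l -> l < 1 ->
       s = (fun A => l * s1 A + (1 - l) * s2 A) -> s1 = s2].

Definition Dset : set (set (X -> R)) :=
  [set F | exists2 U : set X, nbhs (0 : X) U &
             CU_U U F /\ F = wclosure (extreme_points F)].

Definition Dpos (P : set X) : set (set (X -> R)) := Dset `&` CU_pos P.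

Definition dH (A : X) (F G : set (X -> R)) : \bar R :=
  maxe
    (ereal_sup [set x | exists2 s, F s &
        x = ereal_inf [set y | exists2 t, G t & y = (`|s A - t A|)%:E]])
    (ereal_sup [set x | exists2 t, G t &
        x = ereal_inf [set y | exists2 s, F s & y = (`|s A - t A|)%:E]]).

Definition hball (As : seq X) (e : R) (F G : set (X -> R)) : Prop :=
  forall A, A \in As -> (dH A F G < e%:E)%E.

Definition hopen_in (S O : set (set (X -> R))) : Prop :=
  O `<=` S /\
  forall F, O F -> exists (As : seq X) (e : R),
    0 < e /\ forall G, S G -> hball As e F G -> O G.

Definition hdense_in (S D : set (set (X -> R))) : Prop :=
  D `<=` S /\
  forall F, S F -> forall (As : seq X) (e : R), 0 < e ->
    exists2 G, D G & hball As e F G.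

Definition hGdelta_in (S D : set (set (X -> R))) : Prop :=
  exists O : nat -> set (set (X -> R)),
    (forall n, hopen_in S (O n)) /\ D = \bigcap_n O n.

End Defs.

(* Main.v *)
(** If [U' <= [A1, A2]], a positive functional [s] satisfies
    [|s| <= |s A1| + |s A2|] on [U'], so positive functionals are automatically
    continuous and sets of them with bounded values at [A1], [A2] are relatively
    weak*-compact.

    Density.  Let [h s] be the distance of [s] to [F] on the finitely many test
    vectors, and let [K] be the set of positive [s] with
    [h s + eta * (sum_n s(x_n)^2 + sum_n s(y_n)^2) <= c], where the [y_n] are
    rescaled from a dense sequence.  The potential is strictly convex, so every
    point of [K] beyond which the potential exceeds [c] is extreme.  The [x_n] are
    chosen together with positive functionals [tau_n] so that [x_n] is killed by a
    finite net of [F] (hence [K] is close to [F]) and by all [tau_m], [m < n],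
    while [tau_n -> 0] weak* and [tau_n(x_n) -> oo]: moving from any point of [K]
    in the direction [tau_n] leaves [K] within an arbitrarily small weak*
    distance.  Positive functionals separate points by Hahn-Banach, which together
    with infinite dimension provides the [x_n] and [tau_n].

    G_delta.  [F] is the closure of its extreme points iff for every [sg] in [F]
    and every [n] there is [A] with [h_F(A + y_j) < h_F(A) + sg(y_j) + 1/n] for
    [j < n], [h_F] being the support function: such an [A] has its maximal face,
    hence an extreme point, close to [sg].  For fixed [n] this is an open
    condition, by compactness. *)

Require Import Defs.
From HB Require Import structures.
From mathcomp Require Import all_boot all_order all_algebra.
From mathcomp Require Import all_classical all_reals all_analysis.
From mathcomp Require Import ring lra.
Set Implicit Arguments. Unset Strict Implicit. Unset Printing Implicit Defensive.
Import Order.TTheory GRing.Theory Num.Theory.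
Import numFieldNormedType.Exports.
Local Open Scope classical_set_scope.
Local Open Scope ring_scope.

(** * Hahn-Banach domination by sublinear functionals *)

Section HahnBanach.
Context (R : realType) (V : lmodType R).

Definition sublinear (p : V -> R) : Prop :=
  (forall x y, p (x + y) <= p x + p y) /\
  (forall (l : R) x, 0 < l -> p (l *: x) <= l * p x).

Lemma sublinear0 p : sublinear p -> p 0 = 0.
Proof.
move=> [_ hp].
have h1 := hp 2 0 ltac:(lra); have h2 := hp (2^-1) 0 ltac:(lra).
rewrite !scaler0 in h1 h2; lra.
Qed.

Lemma sublinearZ p (l : R) x : sublinear p -> 0 <= l -> p (l *: x) = l * p x.
Proof.
move=> sp; rewrite le_eqVlt => /orP[/eqP <-|l0].
  by rewrite scale0r mul0r sublinear0.
apply/eqP; rewrite eq_le; apply/andP; split; first exact: sp.2.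
have := sp.2 l^-1 (l *: x) ltac:(by rewrite invr_gt0).
by rewrite scalerA mulVf ?gt_eqF// scale1r mulrC ler_pdivlMr// mulrC.
Qed.

Lemma sublinear_ge p x : sublinear p -> - p (- x) <= p x.
Proof.
move=> sp; have := sp.1 x (- x); rewrite subrr sublinear0//; lra.
Qed.

(** Serves three infima: over shifts along a half-line, over a chain of sublinear functionals, and
    in the gauge of an order unit. *)
Lemma inf_sublinear (S : V -> set R) :
  (forall x, S x !=set0) -> (forall x, has_lbound (S x)) ->
  (forall x y a b, S x a -> S y b -> exists2 c, S (x + y) c & c <= a + b) ->
  (forall (l : R) x a, 0 < l -> S x a -> exists2 c, S (l *: x) c & c <= l * a) ->
  sublinear (fun x => inf (S x)).
Proof.
move=> S0 lS SD SZ; split=> [x y|l x l0].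
  rewrite -lerBlDr; apply: lb_le_inf => // a Sa.
  rewrite lerBlDr -lerBlDl; apply: lb_le_inf => // b Sb.
  rewrite lerBlDl; have [c Sc cab] := SD _ _ _ _ Sa Sb.
  exact: le_trans (ge_inf (lS _) Sc) cab.
rewrite -ler_pdivrMl//; apply: lb_le_inf => // a Sa.
rewrite ler_pdivrMl//; have [c Sc cab] := SZ _ _ _ l0 Sa.
exact: le_trans (ge_inf (lS _) Sc) cab.
Qed.

(** Forces additivity along [x0]: [t = 0] gives [shift_inf p x0 <= p], and [t = 1] at [- x0] gives
    [shift_inf p x0 (- x0) <= - p x0]. *)
Definition shift_inf (p : V -> R) (x0 x : V) : R :=
  inf [set p (x + t *: x0) - t * p x0 | t in [set t | 0 <= t]].

Lemma shift_inf_lbound p x0 x : sublinear p ->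
  lbound [set p (x + t *: x0) - t * p x0 | t in [set t | 0 <= t]] (- p (- x)).
Proof.
move=> sp _ [t /= t0 <-]; have := sp.1 (x + t *: x0) (- x).
rewrite addrAC subrr add0r sublinearZ//; lra.
Qed.

Lemma shift_inf_le p x0 x t : sublinear p -> 0 <= t ->
  shift_inf p x0 x <= p (x + t *: x0) - t * p x0.
Proof.
move=> sp t0; apply: ge_inf; last by exists t.
by exists (- p (- x)); exact: shift_inf_lbound.
Qed.

Lemma shift_inf_sublinear p x0 : sublinear p -> sublinear (shift_inf p x0).
Proof.
move=> sp; apply: inf_sublinear => [x|x|x y _ _ [s /= s0 <-] [t /= t0 <-]|].
- by exists (p (x + 0 *: x0) - 0 * p x0), 0 => /=.
- by exists (- p (- x)); exact: shift_inf_lbound.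
- exists (p (x + y + (s + t) *: x0) - (s + t) * p x0).
    by exists (s + t) => //=; exact: addr_ge0.
  have := sp.1 (x + s *: x0) (y + t *: x0).
  by rewrite addrACA -scalerDl; lra.
- move=> l x _ l0 [t /= t0 <-].
  exists (p (l *: x + (l * t) *: x0) - l * t * p x0).
    by exists (l * t) => //=; apply: mulr_ge0 => //; exact: ltW.
  have := sp.2 l (x + t *: x0) l0.
  by rewrite scalerDr scalerA; lra.
Qed.

(* A minimal sublinear functional [q] coincides with all its [shift_inf q x0],
   which forces [q (- x0) <= - q x0]: it is odd, hence linear. *)
Lemma minimal_sublinear p : sublinear p ->
  exists q, [/\ sublinear q, forall x, q x <= p x &
    forall r, sublinear r -> (forall x, r x <= q x) -> r = q].
Proof.
move=> sp; pose T := {q : V -> R | sublinear q /\ forall x, q x <= p x}.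
pose le (q r : T) := `[< forall x, sval r x <= sval q x >].
have [||||[q [sq qp]] qmin] := @Zorn T le.
- by move=> t; apply/asboolP.
- move=> r s t /asboolP rs /asboolP st; apply/asboolP => x.
  exact: le_trans (st x) (rs x).
- move=> [s hs] [t ht] /asboolP /= st /asboolP /= ts.
  have e : s = t by apply/funext => x; apply/eqP; rewrite eq_le st ts.
  by subst t; congr exist; exact: Prop_irrelevance.
- move=> A tA; have [[a0 Aa0]|A0] := pselect (A !=set0); last first.
    have [q0] : inhabited T by constructor; exists p.
    by exists q0 => s As; case: A0; exists s.
  pose S x := [set sval q x | q in A].
  have lS x : lbound (S x) (- p (- x)).
    move=> _ [q Aq <-]; apply: le_trans (sublinear_ge _ (svalP q).1).
    by rewrite lerN2; exact: (svalP q).2.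
  have hS x : has_lbound (S x) by exists (- p (- x)).
  have sS : sublinear (fun x => inf (S x)).
    apply: inf_sublinear => // [x|x y _ _ [q Aq <-] [r Ar <-]|l x _ l0 [q Aq <-]].
    + by exists (sval a0 x), a0.
    + have [/asboolP qr|/asboolP rq] := tA _ _ Aq Ar.
        exists (sval r (x + y)); first by exists r.
        by apply: le_trans ((svalP r).1.1 x y) _; rewrite lerD2r.
      exists (sval q (x + y)); first by exists q.
      by apply: le_trans ((svalP q).1.1 x y) _; rewrite lerD2l.
    + by exists (sval q (l *: x)); [exists q|exact: (svalP q).1.2].
  have Sp x : inf (S x) <= p x.
    apply: le_trans ((svalP a0).2 x); apply: ge_inf => //.
    by exists a0.
  exists (exist _ (fun x => inf (S x)) (conj sS Sp)) => s As.
  by apply/asboolP => x /=; apply: ge_inf => //; exists s.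
exists q; split => // r sr rq.
have rp x : r x <= p x by exact: le_trans (rq x) (qp x).
by have := qmin (exist _ r (conj sr rp)); move/(_ ltac:(exact/asboolP)) => [].
Qed.

(** A minimal functional below [shift_inf p x0] is at most [- p x0] at [- x0]; being odd, it reaches
    [p x0] at [x0]. *)
Theorem hahn_banach_dominated (p : V -> R) (x0 : V) : sublinear p ->
  exists f : V -> R, [/\ forall (a : R) x y, f (a *: x + y) = a * f x + f y,
    forall x, f x <= p x & p x0 <= f x0].
Proof.
move=> sp; have [f [sf fp fmin]] := minimal_sublinear (shift_inf_sublinear x0 sp).
have fN x : f (- x) = - f x.
  apply/eqP; rewrite eq_le; apply/andP; split; last first.
    by have := sublinear_ge (- x) sf; rewrite opprK.
  have fe : shift_inf f x = f.
    apply: fmin; first exact: shift_inf_sublinear.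
    by move=> y; have := shift_inf_le x y sf (lexx 0); rewrite scale0r addr0; lra.
  have := shift_inf_le x (- x) sf (@ler01 R).
  by rewrite fe scale1r addNr sublinear0//; lra.
have fD x y : f (x + y) = f x + f y.
  apply/eqP; rewrite eq_le sf.1 /=.
  by have := sf.1 (x + y) (- y); rewrite addrK fN; lra.
exists f; split=> [a x y|x|].
- rewrite fD; congr (_ + _).
  have [a0|a0] := lerP 0 a; first exact: sublinearZ.
  by rewrite -[a *: x]opprK fN -scaleNr sublinearZ ?oppr_ge0 ?ltW//; lra.
- apply: le_trans (fp x) _.
  by have := shift_inf_le x0 x sp (lexx 0); rewrite scale0r addr0; lra.
- have := le_trans (fp (- x0)) (shift_inf_le x0 (- x0) sp ler01).
  by rewrite scale1r addNr sublinear0// fN; lra.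
Qed.

End HahnBanach.

(** * Linear functionals: continuity and common kernels *)

Section LinearFunctionals.
Context (R : realType) (X : tvsType R).
Implicit Types (s t : X -> R) (x y : X) (U : set X).

Lemma lin_fun0 s : lin_fun s -> s 0 = 0.
Proof. by move=> ls; have := ls 1 0 0; rewrite scaler0 addr0; lra. Qed.

Lemma lin_funD s x y : lin_fun s -> s (x + y) = s x + s y.
Proof. by move=> ls; have := ls 1 x y; rewrite scale1r mul1r. Qed.

Lemma lin_funZ s (a : R) x : lin_fun s -> s (a *: x) = a * s x.
Proof. by move=> ls; have := ls a x 0; rewrite addr0 lin_fun0// addr0. Qed.

Lemma lin_funN s x : lin_fun s -> s (- x) = - s x.
Proof. by move=> ls; rewrite -scaleN1r lin_funZ// mulN1r. Qed.

Lemma lin_funB s x y : lin_fun s -> s (x - y) = s x - s y.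
Proof. by move=> ls; rewrite lin_funD// lin_funN. Qed.

Lemma lin_fun_comb s t (a b : R) : lin_fun s -> lin_fun t ->
  lin_fun (fun x => a * s x + b * t x).
Proof. by move=> ls lt c x y; rewrite ls lt; ring. Qed.

Lemma nbhs0_scale U x : nbhs (0 : X) U ->
  exists2 d : R, 0 < d & forall r : R, `|r| < d -> U (r *: x).
Proof.
move=> U0; have /= := @scale_continuous R X (0, x) U.
rewrite scale0r => /(_ U0)[]/= [B1 B2] /= [[d /= d0 dB] /nbhs_singleton B2x] BU.
exists d => // r rd; apply: (BU (r, x)); split => //=.
by apply: dB => /=; rewrite sub0r normrN.
Qed.

Lemma lin_fun_bounded_continuous s U (M : R) : lin_fun s -> nbhs (0 : X) U ->
  (forall x, U x -> s x <= M) -> continuous s.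
Proof.
move=> ls U0 sM.
have M0 : 0 <= M by rewrite -(lin_fun0 ls); apply: sM; exact: nbhs_singleton.
move=> x; apply/cvgrPdist_lt => e e0.
pose r := e / (M + 1).
have r0 : 0 < r by rewrite divr_gt0//; lra.
have rM : r * M < e by rewrite /r mulrAC ltr_pdivrMr; [nra|lra].
(* Symmetrizing [U] turns the one-sided bound into a bound on [|s|]. *)
have UU : nbhs (0 : X) (U `&` (-%R @` U)) by apply: filterI => //; exact: nbhs0N.
have /(nbhsT x) := nbhs0Z (lt0r_neq0 r0) UU.
apply: filterS => _ [_ [y [Uy [z Uz zy]] <-] <-].
rewrite lin_funD// lin_funZ// opprD addNKr normrN normrM gtr0_norm//.
have := sM _ Uy; have := sM _ Uz; rewrite -zy lin_funN// => h1 h2.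
have : `|- s z| <= M by rewrite ler_norml; apply/andP; split; lra.
by move=> h; apply: le_lt_trans rM; apply: ler_wpM2l => //; exact: ltW.
Qed.

(** Used contrapositively: a vector with [s x != 0] misses some 0-neighborhood, as
    [lin_pos_separates] requires. *)
Lemma continuous_lin_fun_small s x : dual s ->
  (forall U, nbhs (0 : X) U -> U x) -> s x = 0.
Proof.
move=> [ls cs] xU; apply/eqP; rewrite -normr_le0 leNgt; apply/negP => sx0.
have /cvgrPdist_lt /(_ _ sx0) /xU /= := cs 0.
by rewrite lin_fun0// sub0r normrN ltxx.
Qed.

(** Elimination: if some [x] killed by the tail has [r x != 0], the induction hypothesis applies to
    [s - (s x / r x) r]; otherwise [r] vanishes wherever the tail does and gets coefficient 0. *)
Lemma span_of_kernel (rs : seq (X -> R)) s : lin_fun s ->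
  (forall r, r \in rs -> lin_fun r) ->
  (forall x, (forall r, r \in rs -> r x = 0) -> s x = 0) ->
  exists c : nat -> R, forall x, s x = \sum_(i < size rs) c i * nth (fun=> 0) rs i x.
Proof.
elim: rs s => [|r rs IH] s ls lrs ks.
  by exists (fun=> 0) => x; rewrite big_ord0 ks.
have lr : lin_fun r by apply: lrs; rewrite mem_head.
have lrs' q : q \in rs -> lin_fun q by move=> qrs; apply: lrs; rewrite inE qrs orbT.
have [[x [xrs rx]]|none] := pselect (exists x, (forall q, q \in rs -> q x = 0) /\ r x != 0).
  have lt : lin_fun (fun y => 1 * s y + (- s x / r x) * r y) by exact: lin_fun_comb.
  have [|c cE] := IH _ lt lrs'.
    move=> y yrs.
    have /ks : forall q, q \in r :: rs -> q (- (r y / r x) *: x + y) = 0.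
      move=> q; rewrite inE => /orP[/eqP ->|qrs].
        by rewrite lr mulNr divfK// addNr.
      by rewrite lrs'// (xrs _ qrs) (yrs _ qrs) mulr0 addr0.
    rewrite ls mul1r => /eqP; rewrite addrC addr_eq0 => /eqP ->.
    by field.
  exists (fun i => if i is j.+1 then c j else s x / r x) => y.
  rewrite big_ord_recl /=; have := cE y.
  by move=> <-; field.
have [|c cE] := IH s ls lrs'.
  move=> x xrs; apply: ks => q; rewrite inE => /orP[/eqP ->|]; last exact: xrs.
  by apply: contrapT => /eqP rx; apply: none; exists x.
exists (fun i => if i is j.+1 then c j else 0) => y.
by rewrite big_ord_recl /= mul0r add0r cE.
Qed.

(** Otherwise every [sq n] is in the span of the [k] functionals [rs]; the coefficient matrix of the
    first [k + 1] of them has a nonzero left kernel vector, which is a linear relation. *)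
Lemma lin_indep_kernel (sq : nat -> (X -> R)) (rs : seq (X -> R)) :
  (forall n, lin_fun (sq n)) -> lin_indep_seq sq ->
  (forall r, r \in rs -> lin_fun r) ->
  exists n x, (forall r, r \in rs -> r x = 0) /\ sq n x != 0.
Proof.
move=> lsq isq lrs; apply: contrapT => none.
have span n : exists c : nat -> R,
    forall x, sq n x = \sum_(i < size rs) c i * nth (fun=> 0) rs i x.
  have [//|//||c cE] := @span_of_kernel rs (sq n).
    move=> x xrs; apply: contrapT => /eqP nx; apply: none.
    by exists n, x.
  by exists c.
have {span} /choice[c cE] := span.
set k := size rs in cE.
pose M := \matrix_(n < k.+1, i < k) c n i.
have : kermx M != 0.
  by rewrite kermx_eq0 /row_free neq_ltn ltnS rank_leq_col.
case/rowV0Pn => v /sub_kermxP vM v0.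
case/rV0Pn: v0 => i vi; apply/negP: vi; rewrite negbK; apply/eqP.
have := isq k.+1 (fun i => if insub i is Some j then v ord0 j else 0).
move=> /(_ _ i (ltn_ord i)); rewrite valK; apply => x.
under eq_bigr => j _ do rewrite valK cE mulr_sumr.
rewrite exchange_big /= big1 // => j _.
under eq_bigr => n _ do rewrite mulrA.
rewrite -mulr_suml; have /matrixP /(_ ord0 j) := vM; rewrite !mxE => e.
suff -> : \sum_(n < k.+1) v ord0 n * c n j = 0 by rewrite mul0r.
by rewrite -[RHS]e; apply: eq_bigr => n _; rewrite mxE.
Qed.

End LinearFunctionals.

(** * Positive functionals and the order unit [A2] *)

Section PositiveFunctionals.
Context (R : realType) (X : tvsType R) (P : set X) (A1 A2 : X) (W : set X).
Hypothesis coneP : convex_cone P.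
Hypothesis W0 : nbhs (0 : X) W.
Hypothesis WA : W `<=` order_interval P A1 A2.
Implicit Types (s t : X -> R) (x y : X) (U : set X).

Definition lin_pos s := lin_fun s /\ forall A, P A -> 0 <= s A.

(** Substitute for a dual norm: it bounds a positive functional on all of [W]. *)
Definition enorm s := `|s A1| + `|s A2|.

Lemma enorm_ge0 s : 0 <= enorm s. Proof. exact: addr_ge0. Qed.

Lemma lin_pos_bound s x : lin_pos s -> W x -> `|s x| <= enorm s.
Proof.
move=> [ls ps] /WA[/ps + /ps]; rewrite !lin_funB// !subr_ge0 => h1 h2.
have := ler_norm (s A2); have := ler_norm (- s A1); rewrite normrN => h3 h4.
have := normr_ge0 (s A1); have := normr_ge0 (s A2) => h5 h6.
by rewrite ler_norml /enorm; apply/andP; split; lra.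
Qed.

Lemma dual_posE s : dual_pos P s <-> lin_pos s.
Proof.
split=> [[[ls _] ps]|ps] //; split; last exact: ps.2.
split; first exact: ps.1.
apply: (@lin_fun_bounded_continuous _ _ s W (enorm s) ps.1 W0) => x Wx.
exact: le_trans (ler_norm _) (lin_pos_bound ps Wx).
Qed.

Lemma lin_pos_bound_scaled x : exists2 t : R, 0 < t &
  forall s, lin_pos s -> `|s x| <= t * enorm s.
Proof.
have [d d0 dW] := nbhs0_scale x W0.
exists (2 / d); first by rewrite divr_gt0.
move=> s ps; have /dW /(lin_pos_bound ps) : `|d / 2| < d.
  by rewrite gtr0_norm ?divr_gt0//; lra.
rewrite (lin_funZ _ _ ps.1) normrM gtr0_norm ?divr_gt0// => h.
by rewrite mulrAC ler_pdivlMr// mulrC; lra.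
Qed.

(** Hahn-Banach for the gauge [p] of [A2]. Functionals below [p] are positive; were [p] nonpositive
    at both [x] and [- x], then [x] would lie between [- e A2] and [e A2] for every [e > 0], hence
    in every 0-neighborhood. *)
Lemma lin_pos_separates x :
  (forall U, nbhs (0 : X) U -> exists B1 B2 : X,
     exists2 V : set X, nbhs (0 : X) V &
       V `<=` order_interval P B1 B2 /\ order_interval P B1 B2 `<=` U) ->
  ~ (forall U, nbhs (0 : X) U -> U x) -> exists2 s, lin_pos s & s x != 0.
Proof.
move=> hP xU; have [PZ PD] := coneP.
have W00 := nbhs_singleton W0.
have PA2 : P A2 by have [_] := WA W00; rewrite subr0.
pose S y := [set t : R | 0 < t /\ P (t *: A2 - y)].
have S0 y : S y !=set0.
  have [d d0 dW] := nbhs0_scale y W0.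
  have d2 : 0 < d / 2 by rewrite divr_gt0.
  exists (d / 2)^-1; split; first by rewrite invr_gt0.
  have /WA[_ h] : W ((d / 2) *: y) by apply: dW; rewrite gtr0_norm//; lra.
  have := PZ (d / 2)^-1 _ ltac:(by rewrite invr_gt0) h.
  by rewrite scalerBr scalerA mulVf ?gt_eqF// scale1r.
have lS y : lbound (S y) 0 by move=> t [/ltW].
have hS y : has_lbound (S y) by exists 0.
pose p y := inf (S y).
have sp : sublinear p.
  apply: inf_sublinear => // [y z a b [a0 Pa] [b0 Pb]|l y a l0 [a0 Pa]].
    exists (a + b) => //; split; first exact: addr_gt0.
    by rewrite scalerDl opprD addrACA; exact: PD.
  exists (l * a) => //; split; first exact: mulr_gt0.
  by rewrite -scalerA -scalerBr; exact: PZ.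
have dom f : (forall (a : R) y z, f (a *: y + z) = a * f y + f z) ->
    (forall y, f y <= p y) -> lin_pos f.
  move=> lf fp; split=> // A PA.
  have : p (- A) <= 0.
    apply/ler_addgt0Pr => e e0; rewrite add0r; apply: ge_inf => //.
    by split => //; rewrite opprK; apply: PD => //; exact: PZ.
  by move=> pA; have := le_trans (fp _) pA; rewrite (lin_funN A lf) oppr_le0.
have [z zx pz] : exists2 z, z = x \/ z = - x & 0 < p z.
  apply: contrapT => none; apply: xU => U U0.
  have small z (e : R) : z = x \/ z = - x -> 0 < e -> P (e *: A2 - z).
    move=> zx e0.
    have : inf (S z) < e.
      by apply: le_lt_trans e0; rewrite leNgt; apply/negP => pz; apply: none; exists z.
    case/(inf_lt (S0 z)) => t [t0 Pt] te.
    rewrite -(subrK t e) scalerDl -addrA; apply: PD => //.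
    by apply: PZ => //; rewrite subr_gt0.
  have [B1 [B2 [V V0 [VB BU]]]] := hP U U0.
  have [d d0 dV] := nbhs0_scale A2 V0.
  (* Both [(d / 2) A2] and its opposite lie in [[B1, B2]], hence so does [x], which is between
     them. *)
  have /VB[_ P1] : V ((d / 2) *: A2) by apply: dV; rewrite gtr0_norm; lra.
  have /VB[P2 _] : V (- (d / 2) *: A2) by apply: dV; rewrite normrN gtr0_norm; lra.
  apply: BU; split.
    have := PD _ _ P2 (small (- x) (d / 2) (or_intror erefl) ltac:(lra)).
    by rewrite scaleNr opprK addrAC addrA addNr add0r addrC.
  have := PD _ _ P1 (small x (d / 2) (or_introl erefl) ltac:(lra)).
  by rewrite addrA subrK.
have [f [lf fp fz]] := hahn_banach_dominated z sp.
exists f; first exact: dom.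
case: zx pz fz => -> pz fz; first by rewrite gt_eqF// (lt_le_trans pz).
by rewrite -oppr_eq0 -(lin_funN x lf) gt_eqF// (lt_le_trans pz).
Qed.

End PositiveFunctionals.

(** * Hausdorff pseudometrics and finite nets *)

Section HausdorffDistance.
Context (R : realType) (X : tvsType R).
Implicit Types (A : X) (F G : set (X -> R)).

Lemma dH_lt_approx A (e : R) F G : (dH A F G < e%:E)%E ->
  (forall s, F s -> exists2 t, G t & `|s A - t A| < e) /\
  (forall t, G t -> exists2 s, F s & `|s A - t A| < e).
Proof.
rewrite /dH gt_max => /andP[h1 h2]; split=> s Fs.
  have : (ereal_inf [set y | exists2 t, G t & y = `|s A - t A|%:E] < e%:E)%E.
    by apply: le_lt_trans h1; apply: ereal_sup_ubound; exists s.
  by case/ereal_inf_lt => _ [t Gt ->]; rewrite lte_fin => ?; exists t.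
have : (ereal_inf [set y | exists2 t, F t & y = `|t A - s A|%:E] < e%:E)%E.
  by apply: le_lt_trans h2; apply: ereal_sup_ubound; exists s.
by case/ereal_inf_lt => _ [t Gt ->]; rewrite lte_fin => ?; exists t.
Qed.

(** The gap between [d] and [e] keeps the inequality strict after passing to the supremum. *)
Lemma approx_dH_lt A (d e : R) F G : d < e ->
  (forall s, F s -> exists2 t, G t & `|s A - t A| <= d) ->
  (forall t, G t -> exists2 s, F s & `|s A - t A| <= d) ->
  (dH A F G < e%:E)%E.
Proof.
move=> de h1 h2; apply: (@le_lt_trans _ _ d%:E); last by rewrite lte_fin.
rewrite /dH ge_max; apply/andP; split; apply: ge_ereal_sup => _ [s Fs ->].
  have [t Gt st] := h1 s Fs; apply: (@le_trans _ _ `|s A - t A|%:E).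
    by apply: ereal_inf_lbound; exists t.
  by rewrite lee_fin.
have [t Gt st] := h2 s Fs; apply: (@le_trans _ _ `|t A - s A|%:E).
  by apply: ereal_inf_lbound; exists t.
by rewrite lee_fin.
Qed.

(** Points are sorted into slabs of width [e] by their value at one vector, and the induction
    hypothesis handles the other vectors inside each slab. *)
Lemma finite_net (L : seq X) F (e : R) : 0 < e ->
  (forall A, A \in L -> exists M : R, forall f, F f -> `|f A| <= M) ->
  exists rs : seq (X -> R), (forall r, r \in rs -> F r) /\
    forall f, F f -> exists2 r, r \in rs & forall A, A \in L -> `|f A - r A| < e.
Proof.
move=> e0; elim: L F => [|A L IH] F bF.
  have [[f Ff]|F0] := pselect (F !=set0); last first.
    by exists [::]; split => // f Ff; exfalso; apply: F0; exists f.
  exists [:: f]; split => [r|g Fg]; first by rewrite inE => /eqP ->.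
  by exists f; rewrite ?inE.
have inner k : forall (a : R) G, G `<=` F ->
    (forall f, G f -> a <= f A /\ f A < a + k%:R * e) ->
    exists rs : seq (X -> R), (forall r, r \in rs -> G r) /\
    forall f, G f -> exists2 r, r \in rs &
      forall B, B \in A :: L -> `|f B - r B| < e.
  elim: k => [|k IHk] a G GF Ga.
    by exists [::]; split => // f /Ga[]; rewrite mul0r; lra.
  have [|rs1 [rs1G rs1n]] := IH [set f | G f /\ f A < a + e].
    move=> B BL; have [|M FM] := bF B; first by rewrite inE BL orbT.
    by exists M => f [/GF + _]; exact: FM.
  have [||rs2 [rs2G rs2n]] := IHk (a + e) [set f | G f /\ a + e <= f A].
  - by move=> f [/GF].
  - by move=> f [/Ga]; rewrite -natr1; lra.
  exists (rs1 ++ rs2); split => [r|f Gf].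
    by rewrite mem_cat => /orP[/rs1G[]|/rs2G[]].
  have [fA|fA] := ltP (f A) (a + e).
    have [r r1 fr] := rs1n f (conj Gf fA).
    exists r; first by rewrite mem_cat r1.
    move=> B; rewrite inE => /orP[/eqP ->|]; last exact: fr.
    have [Gr rA] := rs1G r r1.
    have [+ _] := Ga _ Gf; have [+ _] := Ga _ Gr => h1 h2.
    by rewrite ltr_norml; apply/andP; split; lra.
  have [r r2 fr] := rs2n f (conj Gf fA).
  by exists r => //; rewrite mem_cat r2 orbT.
have [M FM] := bF A (mem_head _ _).
have [k kM] : exists k : nat, 2 * M < k%:R * e.
  exists (Num.truncn (2 * M / e)).+1; rewrite -ltr_pdivrMr//.
  exact: truncnS_gt.
apply: (inner k (- M)) => // f /FM; rewrite ler_norml => /andP[]; lra.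
Qed.

End HausdorffDistance.

(** * Ingredients of the convex potential *)

Section Potential.
Context (R : realType) (X : tvsType R).
Implicit Types (s t : X -> R) (L : seq X) (F : set (X -> R)) (z : nat -> X).

Definition pdist L s t : R := \sum_(A <- L) `|s A - t A|.

Definition fdist L F s : R := inf [set pdist L s f | f in F].

(** Partial sums: conditions on the whole series are stated as bounds uniform in [N]. *)
Definition sqsum z N s : R := \sum_(n < N) (s (z n)) ^+ 2.

Lemma pdist_ge0 L s t : 0 <= pdist L s t.
Proof. exact: sumr_ge0. Qed.

Lemma le_pdist L s t A : A \in L -> `|s A - t A| <= pdist L s t.
Proof.
move=> AL; rewrite /pdist (big_rem A)//= lerDl; exact: sumr_ge0.
Qed.

Lemma fdist_has_lbound L F s : has_lbound [set pdist L s f | f in F].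
Proof. by exists 0 => _ [f _ <-]; exact: pdist_ge0. Qed.

Lemma fdist_le L F s f : F f -> fdist L F s <= pdist L s f.
Proof. by move=> Ff; apply: ge_inf; [exact: fdist_has_lbound|exists f]. Qed.

Lemma fdist_ge0 L F s : F !=set0 -> 0 <= fdist L F s.
Proof.
move=> [f Ff]; apply: lb_le_inf; first by exists (pdist L s f), f.
by move=> _ [g _ <-]; exact: pdist_ge0.
Qed.

Lemma fdist_mem L F s : F s -> fdist L F s <= 0.
Proof.
move=> Fs; apply: le_trans (fdist_le L s Fs) _.
by rewrite /pdist big1// => A _; rewrite subrr normr0.
Qed.

Lemma fdist_lt L F s (e : R) : F !=set0 -> fdist L F s < e ->
  exists2 f, F f & pdist L s f < e.
Proof.
move=> [f Ff] /inf_lt[]; first by exists (pdist L s f), f.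
by move=> _ [g Fg <-] ge; exists g.
Qed.

Lemma fdist_lip L F s t : F !=set0 -> fdist L F s <= fdist L F t + pdist L s t.
Proof.
move=> [f0 Ff0]; rewrite -lerBlDr; apply: lb_le_inf.
  by exists (pdist L t f0), f0.
move=> _ [f Ff <-]; rewrite lerBlDr; apply: le_trans (fdist_le L s Ff) _.
rewrite /pdist -big_split /=; apply: ler_sum => A _.
by rewrite addrC; exact: ler_distD.
Qed.

Lemma fdist_convex L F s t (l : R) : F !=set0 -> convex_fset F ->
  0 <= l -> l <= 1 ->
  fdist L F (fun A => l * s A + (1 - l) * t A) <=
  l * fdist L F s + (1 - l) * fdist L F t.
Proof.
move=> F0 cF l0 l1; have ml : 0 <= 1 - l by lra.
apply/ler_addgt0Pr => e e0.
have [f Ff sf] := @fdist_lt L F s (fdist L F s + e) F0 ltac:(lra).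
have [g Fg tg] := @fdist_lt L F t (fdist L F t + e) F0 ltac:(lra).
apply: le_trans (fdist_le L _ (cF _ _ _ Ff Fg l0 l1)) _.
apply: (@le_trans _ _ (l * pdist L s f + (1 - l) * pdist L t g)); last by nra.
rewrite /pdist !mulr_sumr -big_split /=; apply: ler_sum => A _.
have -> : l * s A + (1 - l) * t A - (l * f A + (1 - l) * g A) =
  l * (s A - f A) + (1 - l) * (t A - g A) by ring.
by apply: le_trans (ler_normD _ _) _; rewrite !normrM (ger0_norm l0) (ger0_norm ml).
Qed.

Lemma sqsum_ge0 z N s : 0 <= sqsum z N s.
Proof. by apply: sumr_ge0 => i _; exact: sqr_ge0. Qed.

Lemma le_sqsum z N s n : (n < N)%N -> s (z n) ^+ 2 <= sqsum z N s.
Proof.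
move=> nN; rewrite /sqsum (bigD1 (Ordinal nN))//= lerDl.
by apply: sumr_ge0 => i _; exact: sqr_ge0.
Qed.

Lemma sqsum_mono z N M s : (N <= M)%N -> sqsum z N s <= sqsum z M s.
Proof.
move=> NM; rewrite /sqsum -!(big_mkord xpredT (fun n => s (z n) ^+ 2)).
rewrite [leRHS](@big_cat_nat _ _ _ N)//= lerDl.
by apply: sumr_ge0 => i _; exact: sqr_ge0.
Qed.

(** The last term is the gain that makes the potential strictly convex. *)
Lemma sqsum_conv z N s t (l : R) :
  sqsum z N (fun A => l * s A + (1 - l) * t A) =
  l * sqsum z N s + (1 - l) * sqsum z N t
  - l * (1 - l) * sqsum z N (fun A => s A - t A).
Proof.
rewrite /sqsum !mulr_sumr -big_split -sumrB; apply: eq_bigr => i _ /=; ring.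
Qed.

Lemma sqsumD_le z N s t :
  sqsum z N (fun A => s A + t A) <= 2 * sqsum z N s + 2 * sqsum z N t.
Proof.
rewrite /sqsum !mulr_sumr -big_split /=; apply: ler_sum => i _.
by rewrite -subr_ge0 [leRHS](_ : _ = (s (z i) - t (z i)) ^+ 2) ?sqr_ge0//; ring.
Qed.

(** Summed tangent inequality [a^2 <= b^2 + 2 a (a - b)]; the coefficient of [d] depends on [s]
    only, which gives lower semicontinuity at [s]. *)
Lemma sqsum_near z N s t (d : R) :
  (forall n, (n < N)%N -> `|t (z n) - s (z n)| <= d) ->
  sqsum z N s <= sqsum z N t + d * \sum_(n < N) (2 * `|s (z n)|).
Proof.
move=> ts; rewrite /sqsum mulr_sumr -big_split /=; apply: ler_sum => i _.
have := ts i (ltn_ord i); set a := s _; set b := t _ => h.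
have h1 := normr_ge0 a; have h2 := ler_norm (a * (a - b)).
have : `|a * (a - b)| <= `|a| * d by rewrite normrM distrC ler_wpM2l.
by have := sqr_ge0 (a - b); nra.
Qed.

Lemma pdist_near L s t (d : R) : (forall A, A \in L -> `|t A - s A| <= d) ->
  pdist L s t <= d * (size L)%:R.
Proof.
elim: L => [|A L IH] h; first by rewrite /pdist big_nil mulr0.
rewrite /pdist big_cons /= -natr1 mulrDr mulr1 addrC; apply: lerD.
  by apply: IH => B BL; apply: h; rewrite inE BL orbT.
by rewrite distrC; apply: h; rewrite mem_head.
Qed.

End Potential.

(** * Extreme points of sublevel sets of the potential *)

Section SublevelSet.
Context (R : realType) (X : tvsType R) (P : set X) (A1 A2 : X) (W : set X).
Hypothesis W0 : nbhs (0 : X) W.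
Hypothesis WA : W `<=` order_interval P A1 A2.
Variables (L : seq X) (F : set (X -> R)) (x y : nat -> X) (eta c : R).
Hypotheses (A1L : A1 \in L) (A2L : A2 \in L).
Hypotheses (F0 : F !=set0) (cF : convex_fset F).
Hypotheses (eta0 : 0 < eta) (c0 : 0 < c).
Implicit Types (s t : X -> R) (U : set X).

Definition potential N s : R :=
  fdist L F s + eta * (sqsum x N s + sqsum y N s).

Definition sublevel : set (X -> R) :=
  [set s | lin_pos P s /\ forall N, potential N s <= c].

Lemma potential_mono N M s : (N <= M)%N -> potential N s <= potential M s.
Proof.
move=> NM; rewrite /potential lerD2l; apply: ler_wpM2l; first exact: ltW.
by apply: lerD; exact: sqsum_mono.
Qed.

(** Only the gain of the [y] sums is kept: it is what will distinguish two positive functionals. *)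
Lemma potential_conv N s t (l : R) : 0 <= l -> l <= 1 ->
  potential N (fun A => l * s A + (1 - l) * t A) <=
  l * potential N s + (1 - l) * potential N t -
  eta * (l * (1 - l)) * sqsum y N (fun A => s A - t A).
Proof.
move=> l0 l1; rewrite /potential !sqsum_conv.
have := fdist_convex L s t F0 cF l0 l1.
have : 0 <= eta * (l * (1 - l)) * sqsum x N (fun A => s A - t A).
  apply: mulr_ge0; last exact: sqsum_ge0.
  by apply: mulr_ge0; [exact: ltW|apply: mulr_ge0; lra].
lra.
Qed.

Lemma sublevel_convex : convex_fset sublevel.
Proof.
move=> s t l [ps cs] [pt ct] l0 l1; split.
  split; first exact: lin_fun_comb ps.1 pt.1.
  move=> A PA; apply: addr_ge0; apply: mulr_ge0; rewrite ?subr_ge0//.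
    exact: ps.2.
  exact: pt.2.
move=> N; apply: le_trans (potential_conv N s t l0 l1) _.
have : 0 <= eta * (l * (1 - l)) * sqsum y N (fun A => s A - t A).
  apply: mulr_ge0; last exact: sqsum_ge0.
  by apply: mulr_ge0; [exact: ltW|apply: mulr_ge0; lra].
have := cs N; have := ct N; nra.
Qed.

(** Lower semicontinuity: for fixed [N] the potential involves finitely many vectors, and [C] bounds
    its loss per unit of error on them. *)
Lemma potential_closed N s :
  (forall (As : seq X) (e : R), 0 < e ->
     exists2 t, sublevel t & forall A, A \in As -> `|t A - s A| < e) ->
  potential N s <= c.
Proof.
move=> sK; apply/ler_addgt0Pr => e e0.
pose C := (size L)%:R + eta *
  (\sum_(n < N) (2 * `|s (x n)|) + \sum_(n < N) (2 * `|s (y n)|)).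
have C0 : 0 <= C.
  apply: addr_ge0 => //; apply: mulr_ge0; first exact: ltW.
  by apply: addr_ge0; apply: sumr_ge0 => i _; exact: mulr_ge0.
have d0 : 0 < e / (C + 1) by apply: divr_gt0 => //; lra.
have dC : e / (C + 1) * C <= e by rewrite mulrAC ler_pdivrMr; nra.
set d := e / (C + 1) in d0 dC.
have [t [_ ct] ts] := sK (L ++ [seq x i | i <- iota 0 N] ++
  [seq y i | i <- iota 0 N]) d d0.
have h1 : fdist L F s <= fdist L F t + d * (size L)%:R.
  apply: le_trans (fdist_lip L s t F0) _; rewrite lerD2l.
  by apply: pdist_near => A AL; apply/ltW/ts; rewrite mem_cat AL.
have h2 : sqsum x N s <= sqsum x N t + d * \sum_(n < N) (2 * `|s (x n)|).
  apply: sqsum_near => n nN; apply/ltW/ts; rewrite !mem_cat.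
  by rewrite (map_f x) ?orbT// mem_iota.
have h3 : sqsum y N s <= sqsum y N t + d * \sum_(n < N) (2 * `|s (y n)|).
  apply: sqsum_near => n nN; apply/ltW/ts; rewrite !mem_cat.
  by rewrite (map_f y) ?orbT// mem_iota.
have := ct N; rewrite /potential => h4.
move: dC; rewrite /C; move: h2 h3.
set a := \sum_(n < N) _; set b := \sum_(n < N) _ => h2 h3 dC.
have : eta * (sqsum x N s + sqsum y N s) <=
    eta * (sqsum x N t + sqsum y N t + d * a + d * b).
  by apply: ler_wpM2l; [exact: ltW|lra].
lra.
Qed.

Lemma sublevel_wclosed : wclosed sublevel.
Proof.
split=> [s [ps _]|s [ds sK]]; first exact: ((dual_posE W0 WA s).2 ps).1.
split; last by move=> N; exact: potential_closed.
split; first exact: ds.1.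
move=> A PA; apply/ler_addgt0Pr => e e0.
have [t [[_ pt] _] ts] := sK [:: A] e e0.
have := ts A (mem_head _ _); have := pt A PA.
rewrite ltr_norml => h /andP[]; lra.
Qed.

Lemma sublevel_polar (M : R) : (forall f, F f -> enorm A1 A2 f <= M) ->
  exists2 U, nbhs (0 : X) U & sublevel `<=` polar U.
Proof.
have cc := c0.
move=> FM; have [f0 Ff0] := F0.
have M0 : 0 <= M by apply: le_trans (FM f0 Ff0); exact: enorm_ge0.
(* A point of the sublevel set is within [c + 1] of some [f] in [F] at both [A1] and [A2], so its
   [enorm] is at most [M + 2 * (c + 1)]. *)
pose r := (M + 2 * (c + 1) + 1)^-1.
have r0 : 0 < r by rewrite /r invr_gt0; lra.
exists (( *:%R r : X -> X) @` W); first exact: nbhs0Z (lt0r_neq0 r0) W0.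
move=> s [ps cs]; split; first exact: ((dual_posE W0 WA s).2 ps).1.
move=> _ [w Ww <-]; rewrite (lin_funZ _ _ ps.1) normrM gtr0_norm// mulrC.
rewrite ler_pdivrMr; last lra.
apply: le_trans (lin_pos_bound WA ps Ww) _.
have := cs 0%N; rewrite /potential /sqsum !big_ord0 addr0 mulr0 addr0 => hc.
have hc1 : fdist L F s < c + 1 by lra.
have [f Ff df] := fdist_lt F0 hc1.
have := FM f Ff; rewrite /enorm.
have := le_trans (ler_normB (s A1 - f A1) (- f A1)) (lexx _).
rewrite opprK subrK normrN; have := le_pdist s f A1L.
have := le_trans (ler_normB (s A2 - f A2) (- f A2)) (lexx _).
rewrite opprK subrK normrN; have := le_pdist s f A2L.
lra.
Qed.

Definition sqbounded s := exists C : R, forall N, sqsum x N s + sqsum y N s <= C.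

Hypothesis y_sep : forall s t, lin_pos P s -> lin_pos P t ->
  (forall n, s (y n) = t (y n)) -> s = t.
Variable tau : nat -> (X -> R).
Hypothesis tau_pos : forall n, lin_pos P (tau n).
Hypothesis tau_bounded : forall n, sqbounded (tau n).
Hypothesis tau_diag : forall n, tau n (x n) = n.+1%:R.
Hypothesis tau_small : forall A, exists C : R, forall n, `|tau n A| <= C / n.+1%:R.

(* From a point of the sublevel set, go in the direction [tau n] up to the last
   point inside; were that point a nontrivial convex combination, strict
   convexity of the potential would allow to go further. *)
Lemma sublevel_extreme s n : sublevel s ->
  ~ sublevel (fun A => s A + tau n A) ->
  exists2 u : R, 0 <= u <= 1 &
    extreme_points sublevel (fun A => s A + u * tau n A).
Proof.
move=> Ks notK; pose line (u : R) := fun A => s A + u * tau n A.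
have line_pos u : 0 <= u -> lin_pos P (line u).
  move=> u0; split.
    have := lin_fun_comb 1 u Ks.1.1 (tau_pos n).1.
    by congr lin_fun; apply/funext => A; rewrite mul1r.
  move=> A PA; apply: addr_ge0; first exact: Ks.1.2.
  by apply: mulr_ge0 => //; exact: (tau_pos n).2.
pose T := [set u : R | 0 <= u <= 1 /\ sublevel (line u)].
have T0 : T 0.
  split; first by rewrite lexx ler01.
  by move: Ks; congr sublevel; apply/funext => A; rewrite /line mul0r addr0.
have supT : has_sup T.
  by split; [exists 0|exists 1 => u [/andP[]]].
have hT : has_ubound T := supT.2.
pose u := sup T.
have u01 : 0 <= u <= 1.
  apply/andP; split; first exact: ub_le_sup.
  by apply: ge_sup; [exists 0|move=> v [/andP[]]].
(* The supremum is attained: the sublevel set is weak*-closed and [line v] approaches [line u]. *)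
have Ku : sublevel (line u).
  apply: sublevel_wclosed.2; split.
    exact: ((dual_posE W0 WA _).2 (line_pos u (andP u01).1)).1.
  move=> As e e0.
  pose C := \sum_(A <- As) `|tau n A|.
  have C0 : 0 <= C by exact: sumr_ge0.
  have d0 : 0 < e / (C + 1) by apply: divr_gt0 => //; lra.
  have [v Tv] := sup_adherent d0 supT; rewrite -/u => uv.
  have vu : v <= u by exact: ub_le_sup.
  exists (line v); first exact: Tv.2.
  move=> A AAs; rewrite /line opprD addrACA subrr add0r -mulrBl normrM.
  have tC : `|tau n A| <= C.
    by rewrite /C (big_rem A)//= lerDl; exact: sumr_ge0.
  have : `|v - u| <= e / (C + 1) by rewrite ler_norml; apply/andP; split; lra.
  move=> h; apply: le_lt_trans (ler_wpM2r (normr_ge0 _) h) _.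
  by rewrite mulrAC ltr_pdivrMr; nra.
exists u => //; split=> // s1 s2 l [p1 c1] [p2 c2] l0 l1 E.
apply: contrapT => s12.
have [n0 n0P] : exists n0, s1 (y n0) != s2 (y n0).
  apply: contrapT => none; apply: s12; apply: y_sep => // k.
  by apply: contrapT => /eqP h; apply: none; exists k.
pose d := sqsum y n0.+1 (fun A => s1 A - s2 A).
have d0 : 0 < d.
  have := @le_sqsum _ _ y n0.+1 (fun A => s1 A - s2 A) n0 (ltnSn _).
  by apply: lt_le_trans; rewrite exprn_even_gt0//= subr_eq0.
pose d' := eta * (l * (1 - l)) * d.
have d'0 : 0 < d' by rewrite !mulr_gt0// subr_gt0.
(* A nontrivial combination lowers the potential at [line u] by [d'] for every [N]: beyond [n0] by
   strict convexity, below by monotonicity. *)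
have potu N : potential N (line u) <= c - d'.
  apply: (le_trans (potential_mono _ (leq_maxl N n0.+1))).
  set M := maxn _ _; rewrite /line E.
  apply: (le_trans (potential_conv M s1 s2 (ltW l0) (ltW l1))).
  have := c1 M; have := c2 M.
  have : d' <= eta * (l * (1 - l)) * sqsum y M (fun A => s1 A - s2 A).
    apply: ler_wpM2l; first by rewrite !mulr_ge0 ?subr_ge0// ltW.
    by apply: sqsum_mono; exact: leq_maxr.
  nra.
have [C1 hC1] := tau_bounded n.
have [C CB] : exists C : R, forall N, potential N (line 1) <= C.
  exists (fdist L F (line 1) + eta * (2 * (c / eta) + 2 * C1)) => N.
  rewrite lerD2l; apply: ler_wpM2l; first exact: ltW.
  have -> : line 1 = (fun A => s A + tau n A).
    by apply/funext => A; rewrite /line mul1r.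
  have := sqsumD_le x N s (tau n); have := sqsumD_le y N s (tau n).
  have := hC1 N; have : sqsum x N s + sqsum y N s <= c / eta.
    rewrite ler_pdivlMr// mulrC; have := Ks.2 N; rewrite /potential.
    by have := fdist_ge0 L s F0; lra.
  lra.
have u1 : u < 1.
  rewrite lt_neqAle (andP u01).2 andbT; apply/eqP => u1; apply: notK.
  by move: Ku; rewrite u1; congr sublevel; apply/funext => A; rewrite /line mul1r.
pose v := d' / (d' + `|C - c| + 1).
have n0' := normr_ge0 (C - c).
have v0 : 0 < v by rewrite /v divr_gt0//; lra.
have v1 : v < 1 by rewrite /v ltr_pdivrMr; lra.
have vE : v * (d' + `|C - c| + 1) = d' by rewrite /v divfK// gt_eqF//; lra.
have Tw : T (u + v * (1 - u)).
  have [u0 _] := andP u01; split; first by apply/andP; split; nra.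
  split; first by apply: line_pos; nra.
  move=> N.
  have -> : line (u + v * (1 - u)) =
      (fun A => v * line 1 A + (1 - v) * line u A).
    by apply/funext => A; rewrite /line; ring.
  apply: (le_trans (potential_conv N _ _ (ltW v0) (ltW v1))).
  have : 0 <= eta * (v * (1 - v)) * sqsum y N (fun A => line 1 A - line u A).
    apply: mulr_ge0; last exact: sqsum_ge0.
    by apply: mulr_ge0; [exact: ltW|apply: mulr_ge0; lra].
  have h1 : v * potential N (line 1) <= v * C by rewrite ler_wpM2l ?CB// ltW.
  have h2 : (1 - v) * potential N (line u) <= (1 - v) * (c - d').
    by rewrite ler_wpM2l ?potu// subr_ge0 ltW.
  have h3 : v * (C - c) <= v * `|C - c| by rewrite ler_wpM2l ?ler_norm// ltW.
  nra.
have := ub_le_sup hT Tw; rewrite -/u leNgt => /negP; apply.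
by rewrite ltrDl mulr_gt0// subr_gt0.
Qed.

(** For large [n], adding [tau n] pushes the [x n] term above the level, so an extreme point lies on
    the segment from [s] to [s + tau n], which is short on finitely many vectors. *)
Lemma sublevel_extreme_dense : sublevel = wclosure (extreme_points sublevel).
Proof.
have ee := eta0.
apply/seteqP; split=> [s Ks|s [ds h]]; last first.
  apply: sublevel_wclosed.2; split=> // As e e0.
  by have [t [Kt _] ts] := h As e e0; exists t.
split=> [|As e e0]; first exact: sublevel_wclosed.1.
have [C hC] : exists C : R, forall n A, A \in As -> `|tau n A| <= C / n.+1%:R.
  elim: As => [|A As [C hC]]; first by exists 0.
  have [C' hC'] := tau_small A; exists (`|C| + `|C'|) => n B.
  have i0 : 0 <= n.+1%:R^-1 :> R by rewrite invr_ge0.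
  rewrite inE => /orP[/eqP ->|/hC].
    move/le_trans: (hC' n); apply; apply: ler_wpM2r => //.
    by have := ler_norm C'; have := normr_ge0 C; lra.
  move=> /(_ n)/le_trans; apply; apply: ler_wpM2r => //.
  by have := ler_norm C; have := normr_ge0 C'; lra.
(* As [M > 1] and [eta * M > c], a value of modulus at least [M] at a single [x n] already puts the
   potential above [c]. *)
pose M := c / eta + 1.
have M1 : 1 < M by rewrite ltrDr divr_gt0.
have cM : c < eta * M.
  by rewrite /M mulrDr mulrCA divff ?gt_eqF// mulr1 mulr1 ltrDl.
(* The term [2 * M] brings [s (x n) + tau n (x n)] above [M]; the term [|C| / e] makes [tau n]
   smaller than [e] on [As]. *)
pose n := Num.truncn (2 * M + `|C| / e).
have nM : 2 * M + `|C| / e < n.+1%:R :> R by exact: truncnS_gt.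
have Ce : 0 <= `|C| / e by rewrite divr_ge0// ltW.
have notK : ~ sublevel (fun A => s A + tau n A).
  move=> [_ /(_ n.+1)]; rewrite /potential leNgt => /negP; apply.
  have := fdist_ge0 L (fun A => s A + tau n A) F0.
  have := sqsum_ge0 y n.+1 (fun A => s A + tau n A).
  have := @le_sqsum _ _ x n.+1 (fun A => s A + tau n A) n (ltnSn _).
  rewrite tau_diag.
  have sM : `|s (x n)| < M.
    rewrite ltNge; apply/negP => Ms.
    have := Ks.2 n.+1; rewrite /potential.
    have := fdist_ge0 L s F0; have := sqsum_ge0 y n.+1 s.
    have := @le_sqsum _ _ x n.+1 s n (ltnSn _).
    rewrite -real_normK ?num_real// => h1 h2 h3 h4.
    have h5 : M <= `|s (x n)| ^+ 2 by nra.
    have : eta * M <= eta * (sqsum x n.+1 s + sqsum y n.+1 s).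
      by apply: ler_wpM2l; lra.
    lra.
  move: sM; rewrite ltr_norml => /andP[sM _].
  set a := s (x n) + _; have aM : M < a by rewrite /a; move: nM Ce sM M1; lra.
  have : M < a ^+ 2 by nra.
  set q := sqsum x _ _; set r := sqsum y _ _; set h := fdist _ _ _ => *.
  have : eta * M < eta * (q + r) by rewrite ltr_pM2l//; lra.
  lra.
have [u /andP[u0 u1] Eu] := sublevel_extreme Ks notK.
exists (fun A => s A + u * tau n A) => // A AAs.
rewrite addrAC subrr add0r normrM ger0_norm//.
apply: (@le_lt_trans _ _ (1 * `|tau n A|)); first exact: ler_wpM2r.
rewrite mul1r; apply: le_lt_trans (hC n A AAs) _.
rewrite ltr_pdivrMr// -ltr_pdivrMl//.
apply: le_lt_trans nM; rewrite mulrC.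
have : C / e <= `|C| / e by rewrite ler_wpM2r ?ler_norm// invr_ge0 ltW.
lra.
Qed.

End SublevelSet.

(** * Density: the triangular system and the approximating set *)

Section Density.
Context (R : realType) (X : tvsType R) (P : set X) (A1 A2 : X) (W : set X).
Hypothesis coneP : convex_cone P.
Hypothesis W0 : nbhs (0 : X) W.
Hypothesis WA : W `<=` order_interval P A1 A2.
Implicit Types (s t : X -> R) (U : set X).

Definition dense_range (y : nat -> X) : Prop :=
  forall (x : X) U, nbhs x U -> exists n, U (y n).

Lemma separable_dense_seq : separable_space X ->
  exists y, dense_range y.
Proof.
move=> [D [cD dD]].
have /pfcard_geP[D0|[f]] := cD.
  have : closure D 0 by rewrite dD.
  by move=> /(_ _ (@filterT _ _ (nbhs_filter (0 : X))))[z []]; rewrite D0.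
exists f => x U xU; have : closure D x by rewrite dD.
move=> /(_ U xU)[d [Dd Ud]].
have [n _ fn] := @surj _ _ _ _ f d Dd.
by exists n; rewrite fn.
Qed.

(** Uniform in [s]: [y n] is taken in [A + e W], and [enorm] controls positive functionals on
    [W]. *)
Lemma dense_seq_approx (y : nat -> X) :
  dense_range y ->
  forall A (e : R), 0 < e -> exists n, forall s, lin_pos P s ->
    `|s (y n) - s A| <= e * enorm A1 A2 s.
Proof.
move=> dy A e e0.
have [n [_ [w Ww <-] yn]] := dy _ _ (nbhsT A (nbhs0Z (lt0r_neq0 e0) W0)).
exists n => s ps; rewrite -yn (lin_funD _ _ ps.1) addrAC subrr add0r (lin_funZ _ _ ps.1).
by rewrite normrM gtr0_norm// ler_pM2l//; exact: (lin_pos_bound WA ps Ww).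
Qed.

Lemma dense_seq_separates (y : nat -> X) :
  dense_range y ->
  forall s t, lin_pos P s -> lin_pos P t -> (forall n, s (y n) = t (y n)) -> s = t.
Proof.
move=> dy s t ps pt st; apply/funext => A; apply/eqP; rewrite -subr_eq0 -normr_le0.
apply/ler_addgt0Pr => e e0; rewrite add0r.
have s0 := enorm_ge0 A1 A2 s; have t0 := enorm_ge0 A1 A2 t.
pose C := enorm A1 A2 s + enorm A1 A2 t + 1.
have C0 : 0 < C by rewrite /C; lra.
have [n yn] := dense_seq_approx dy A (divr_gt0 e0 C0).
have h1 := yn s ps; have h2 := yn t pt; rewrite st in h1.
have h3 := ler_distD (t (y n)) (s A) (t A); rewrite (distrC (s A) (t (y n))) in h3.
have : e / C * enorm A1 A2 s + e / C * enorm A1 A2 t <= e.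
  by rewrite -mulrDr mulrAC ler_pdivrMr// ler_pM2l// /C; lra.
lra.
Qed.

Lemma sum_half_pow N : \sum_(n < N) (2^-1 : R) ^+ n <= 2.
Proof.
suff : \sum_(n < N) (2^-1 : R) ^+ n = 2 - 2 * 2^-1 ^+ N.
  by move=> ->; rewrite gerBl mulr_ge0// exprn_ge0// invr_ge0.
elim: N => [|N IH]; first by rewrite big_ord0 expr0; lra.
by rewrite big_ord_recr /= IH exprS; field.
Qed.

(** Scaling [y n] so that [|s (y' n)| <= 2^-n enorm s] makes the squares summable and keeps the
    separation. *)
Lemma dense_seq_rescale (y : nat -> X) : exists y' : nat -> X,
  (forall s t, lin_pos P s -> lin_pos P t ->
     (forall n, s (y' n) = t (y' n)) -> forall n, s (y n) = t (y n)) /\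
  (forall s, lin_pos P s -> forall N, sqsum y' N s <= 2 * enorm A1 A2 s ^+ 2).
Proof.
have /choice[w hw] n : exists w : R, 0 < w /\ forall s, lin_pos P s ->
    `|s (w *: y n)| <= 2^-1 ^+ n * enorm A1 A2 s.
  have [t t0 ht] := lin_pos_bound_scaled W0 WA (y n).
  have h0 : 0 < (2^-1 : R) ^+ n by rewrite exprn_gt0// invr_gt0.
  exists (2^-1 ^+ n / t); split; first exact: divr_gt0.
  move=> s ps; rewrite (lin_funZ _ _ ps.1) normrM gtr0_norm ?divr_gt0//.
  by rewrite -mulrA ler_pM2l// ler_pdivrMl// ht.
exists (fun n => w n *: y n); split=> [s t ps pt st n|s ps N].
  have := st n; rewrite (lin_funZ _ _ ps.1) (lin_funZ _ _ pt.1).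
  by apply: mulfI; rewrite gt_eqF// (hw n).1.
apply: (@le_trans _ _ (enorm A1 A2 s ^+ 2 * \sum_(n < N) 2^-1 ^+ n)).
  rewrite /sqsum mulr_sumr; apply: ler_sum => n _.
  have := (hw n).2 s ps; set a := s _; set b := enorm _ _ _.
  have : 0 <= (2^-1 : R) ^+ n by rewrite exprn_ge0// invr_ge0.
  have : (2^-1 : R) ^+ n <= 1 by rewrite exprn_ile1// ?invr_ge0//; lra.
  set h := 2^-1 ^+ n => h1 h0 ah; have a0 := normr_ge0 a.
  rewrite -(real_normK (num_real a)).
  have : `|a| ^+ 2 <= (h * b) ^+ 2 by rewrite ler_sqr// nnegrE// (le_trans a0).
  have : (h * b) ^+ 2 <= b ^+ 2 * h.
    by rewrite exprMn mulrC ler_wpM2l ?sqr_ge0// expr2 ler_piMl.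
  lra.
by rewrite mulrC ler_wpM2r ?sqr_ge0// sum_half_pow.
Qed.

Hypothesis order_nbhs : forall U, nbhs (0 : X) U -> exists B1 B2 : X,
  exists2 V : set X, nbhs (0 : X) V &
    V `<=` order_interval P B1 B2 /\ order_interval P B1 B2 `<=` U.
Variable sq : nat -> (X -> R).
Hypothesis sq_dual : forall n, dual (sq n).
Hypothesis sq_indep : lin_indep_seq sq.

(** Some [x] is killed by [rs] but not by some [sq k], so a positive [t] has [t x != 0]; [t] is
    scaled to be small, then [x] to fix the diagonal value. Linearity of [rs] is a premise under the
    existential so that choice applies to all lists. *)
Lemma triangular_step (rs : seq (X -> R)) (n : nat) :
  exists p : X * (X -> R), (forall r, r \in rs -> lin_fun r) ->
    [/\ lin_pos P p.2, forall r, r \in rs -> r p.1 = 0,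
        p.2 p.1 = n.+1%:R & enorm A1 A2 p.2 <= n.+1%:R^-1].
Proof.
have [lrs|nrs] := pselect (forall r, r \in rs -> lin_fun r); last first.
  by exists (0, fun=> 0).
have [k [x [rx sx]]] := lin_indep_kernel (fun n => (sq_dual n).1) sq_indep lrs.
have [|t pt tx] := lin_pos_separates coneP W0 WA order_nbhs (x := x).
  by move=> xU; rewrite (continuous_lin_fun_small (sq_dual k) xU) eqxx in sx.
have E0 := enorm_ge0 A1 A2 t.
have n0 : 0 < n.+1%:R :> R by [].
pose a := (n.+1%:R * (enorm A1 A2 t + 1))^-1.
have a0 : 0 < a by rewrite /a invr_gt0 mulr_gt0//; lra.
exists ((n.+1%:R / (a * t x)) *: x, fun A => a * t A) => _ /=; split.
- split; last by move=> A PA; apply: mulr_ge0; [exact: ltW|exact: pt.2].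
  by move=> b y z; rewrite pt.1; ring.
- by move=> r rrs; rewrite (lin_funZ _ _ (lrs r rrs)) (rx _ rrs) mulr0.
- rewrite (lin_funZ _ _ pt.1); field.
  by rewrite tx gt_eqF.
- rewrite /enorm !normrM -mulrDr gtr0_norm// -/(enorm A1 A2 t) /a invfM -mulrA.
  rewrite ler_piMr ?invr_ge0// ler_pdivrMl; lra.
Qed.

Lemma triangular_system (rs : seq (X -> R)) : (forall r, r \in rs -> lin_fun r) ->
  exists (x : nat -> X) (tau : nat -> (X -> R)),
    [/\ forall n, lin_pos P (tau n),
        forall n r, r \in rs -> r (x n) = 0,
        forall m n, (m < n)%N -> tau m (x n) = 0,
        forall n, tau n (x n) = n.+1%:R &
        forall n, enorm A1 A2 (tau n) <= n.+1%:R^-1].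
Proof.
move=> lrs.
have /choice[g hg] : forall q : seq (X -> R) * nat,
    exists p : X * (X -> R), (forall r, r \in q.1 -> lin_fun r) ->
    [/\ lin_pos P p.2, forall r, r \in q.1 -> r p.1 = 0,
        p.2 p.1 = q.2.+1%:R & enorm A1 A2 p.2 <= q.2.+1%:R^-1].
  by move=> [us n]; exact: triangular_step.
(* [st n] holds [rs] and all [tau m] with [m < n], so the next [x n] is killed by each of them. *)
pose st := fix st n := if n is m.+1 then (g (st m, m)).2 :: st m else rs.
have lst n r : r \in st n -> lin_fun r.
  elim: n r => [|n IH] r; first exact: lrs.
  rewrite inE => /orP[/eqP ->|]; last exact: IH.
  by have [[]] := hg (st n, n) (IH).
have st_sub m n r : (m <= n)%N -> r \in st m -> r \in st n.
  elim: n => [|n IH]; first by rewrite leqn0 => /eqP ->.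
  rewrite leq_eqVlt => /orP[/eqP -> //|]; rewrite ltnS => mn rm.
  by rewrite inE (IH mn rm) orbT.
exists (fun n => (g (st n, n)).1), (fun n => (g (st n, n)).2); split=> [n|n r rrs|m n mn|n|n].
- by have [] := hg (st n, n) (lst n).
- by have [_ + _ _] := hg (st n, n) (lst n); apply; exact: (@st_sub 0%N).
- have [_ + _ _] := hg (st n, n) (lst n); apply; apply: (@st_sub m.+1) => //.
  by rewrite /= inE eqxx.
- by have [] := hg (st n, n) (lst n).
- by have [] := hg (st n, n) (lst n).
Qed.

Lemma polar_eval_bounded A U : nbhs (0 : X) U ->
  exists M : R, forall f, polar U f -> `|f A| <= M.
Proof.
move=> U0; have [d d0 dU] := nbhs0_scale A U0.
exists (2 / d) => f [[lf _] fU].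
have := fU _ (dU (d / 2) ltac:(by rewrite gtr0_norm ?divr_gt0//; lra)).
rewrite (lin_funZ _ _ lf) normrM gtr0_norm ?divr_gt0//.
by rewrite ler_pdivlMr// => h; lra.
Qed.

Lemma polar_enorm_bounded B1 B2 U : nbhs (0 : X) U ->
  exists M : R, forall f, polar U f -> enorm B1 B2 f <= M.
Proof.
move=> U0; have [M1 h1] := polar_eval_bounded B1 U0.
have [M2 h2] := polar_eval_bounded B2 U0.
by exists (M1 + M2) => f Uf; apply: lerD; [exact: h1|exact: h2].
Qed.

Lemma Dpos_dense : separable_space X -> hdense_in (CU_pos P) (Dpos P).
Proof.
move=> sepX; split=> [F [] //|F [U U0 [[F0 [cF [wF FU]]] FP]] As e e0].
have [y0 dy0] := separable_dense_seq sepX.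
have [y [ysep ybound]] := dense_seq_rescale y0.
pose L := A1 :: A2 :: As.
have lF f : F f -> lin_pos P f by move=> /FP /(dual_posE W0 WA).
have bF A : exists M : R, forall f, F f -> `|f A| <= M.
  have [M hM] := polar_eval_bounded A U0.
  by exists M => f /FU; exact: hM.
have [M FM] := polar_enorm_bounded A1 A2 U0.
have {}FM f : F f -> enorm A1 A2 f <= M by move=> /FU; exact: FM.
have e2 : 0 < e / 2 by rewrite divr_gt0.
have [rs [rsF rsn]] := finite_net e2 (fun A (_ : A \in L) => bF A).
have [|x [tau [tau_pos xrs tri diag tau_small]]] := @triangular_system rs.
  by move=> r /rsF/lF[].
have M0 : 0 <= M.
  by have [f Ff] := F0; apply: le_trans (FM f Ff); exact: enorm_ge0.
(* The [y] sums are at most [2 * M ^+ 2] on [F]; weighted by [eta] they stay within the level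
   [e / 2]. *)
pose eta := e / 2 / (2 * M ^+ 2 + 1).
have M20 : 0 <= M ^+ 2 by exact: sqr_ge0.
have eta0 : 0 < eta by rewrite /eta divr_gt0//; lra.
have etaM : eta * (2 * M ^+ 2) <= e / 2.
  rewrite /eta mulrAC ler_pdivrMr; last lra.
  by apply: ler_wpM2l; lra.
pose K := sublevel P L F x y eta (e / 2).
have A1L : A1 \in L by rewrite inE eqxx.
have A2L : A2 \in L by rewrite !inE eqxx orbT.
(* Triangularity removes every term of the [x] sum past index [n]. *)
have tau_bounded n : sqbounded x y (tau n).
  exists (sqsum x n.+1 (tau n) + 2 * enorm A1 A2 (tau n) ^+ 2) => N.
  apply: lerD; last exact: ybound.
  have [Nn|nN] := leqP N n.+1; first exact: sqsum_mono.
  rewrite /sqsum -!(big_mkord xpredT (fun k => tau n (x k) ^+ 2)).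
  rewrite (@big_cat_nat _ _ _ n.+1 0%N N)//=; last exact: ltnW.
  rewrite gerDl big_nat_cond big1// => k; rewrite andbT => /andP[nk _].
  by rewrite tri// expr0n.
have tau_lim A : exists C : R, forall n, `|tau n A| <= C / n.+1%:R.
  have [t t0 ht] := lin_pos_bound_scaled W0 WA A.
  exists t => n; apply: le_trans (ht _ (tau_pos n)) _.
  by rewrite ler_pM2l.
have sep s t : lin_pos P s -> lin_pos P t -> (forall n, s (y n) = t (y n)) -> s = t.
  by move=> ps pt st; apply: dense_seq_separates dy0 _ _ ps pt (ysep _ _ ps pt st).
have KE := sublevel_extreme_dense W0 WA L F0 cF eta0 e2 sep tau_pos tau_bounded diag tau_lim.
(* Net points have distance 0 to [F] and vanishing [x] sums; only the [y] sums contribute. *)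
have rsK r : r \in rs -> K r.
  move=> rrs; have Fr := rsF r rrs; split; first exact: lF.
  move=> N; rewrite /potential.
  have -> : sqsum x N r = 0.
    by rewrite /sqsum big1// => n _; rewrite (xrs _ _ rrs) expr0n.
  have := fdist_mem L Fr; rewrite add0r => h1.
  have h2 : eta * sqsum y N r <= eta * (2 * M ^+ 2).
    rewrite ler_pM2l//; apply: le_trans (ybound _ (lF r Fr) N) _.
    rewrite ler_pM2l// ler_sqr ?nnegrE//; [exact: FM|exact: enorm_ge0].
  lra.
have K0 : K !=set0.
  by have [f Ff] := F0; have [r /rsK Kr _] := rsn f Ff; exists r.
have [V V0 KV] := sublevel_polar W0 WA x y eta A1L A2L F0 e2 FM.
have KCU : CU_U V K.
  split=> //; split; first exact: (sublevel_convex F0 cF eta0).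
  by split=> //; exact: (sublevel_wclosed W0 WA L x y _ F0 eta0).
have KP : K `<=` dual_pos P by move=> s [ps _]; apply/(dual_posE W0 WA).
exists K; first by split; exists V.
move=> A AAs; have AL : A \in L by rewrite !inE AAs !orbT.
(* Strictly between the level [e / 2] and [e], leaving room for both [fdist_lt] and
   [approx_dH_lt]. *)
have de : 3 / 4 * e < e by lra.
apply: (approx_dH_lt de) => [f Ff|s [_ /(_ 0%N)]].
  have [r rrs fr] := rsn f Ff; exists r; first exact: rsK.
  by have := fr A AL; lra.
rewrite /potential /sqsum !big_ord0 addr0 mulr0 addr0 => sK.
have sK' : fdist L F s < 3 / 4 * e by lra.
have [f Ff fs] := fdist_lt F0 sK'.
exists f => //; rewrite distrC; exact: le_trans (le_pdist _ _ AL) (ltW fs).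
Qed.

End Density.

(* Bundled, so that the [nbhs] structure of functionals is found from the type. *)
Definition ptws_functions (R : realType) (X : Type) : topologicalType :=
  prod_topology (fun _ : X => (R : topologicalType)).

(** * Pointwise convergence: compactness, faces, separation *)

Section PointwiseTopology.
Context (R : realType) (X : tvsType R).
Local Notation Y := (ptws_functions R X).
Implicit Types (s t : X -> R) (A : X).

Lemma ptws_eval_continuous A : continuous (fun s : Y => s A).
Proof. exact: (@proj_continuous _ (fun _ : X => R) A). Qed.

Lemma ptws_ball_nbhs (s : Y) A (e : R) : 0 < e ->
  nbhs s [set t : Y | `|t A - s A| < e].
Proof.
move=> e0; have /cvgrPdist_lt /(_ e e0) := @ptws_eval_continuous A s.
by apply: filterS => t; rewrite distrC.
Qed.

Lemma ptws_balls_nbhs (s : Y) (As : seq X) (e : R) : 0 < e ->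
  nbhs s [set t : Y | forall A, A \in As -> `|t A - s A| < e].
Proof.
move=> e0; elim: As => [|A As IH]; first by apply: (@filterS _ _ _ setT); [|exact: filterT].
apply: (filterS _ (filterI (@ptws_ball_nbhs s A e e0) IH)) => t [h1 h2] B.
by rewrite inE => /orP[/eqP ->|] //; exact: h2.
Qed.

Lemma ptws_closed (S : set Y) :
  (forall s : Y, (forall (As : seq X) (e : R), 0 < e ->
     exists2 t, S t & forall A, A \in As -> `|t A - s A| < e) -> S s) ->
  closed S.
Proof.
move=> h s cs; apply: h => As e e0.
have [t [St ts]] : S `&` [set t : Y | forall A, A \in As -> `|t A - s A| < e] !=set0.
  exact: (cs _ (ptws_balls_nbhs s As e0)).
by exists t.
Qed.

Lemma halfspace_closed A (a : R) : closed [set s : Y | a <= s A].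
Proof.
apply: ptws_closed => s h; apply/ler_addgt0Pr => e e0.
have [t /= at_ ts] := h [:: A] e e0.
by have := ts A (mem_head _ _); rewrite ltr_norml => /andP[]; lra.
Qed.

Lemma compact_eval_max (S : set Y) A : compact S -> S !=set0 ->
  exists2 s, S s & forall t, S t -> t A <= s A.
Proof.
move=> cS S0.
have [|s] := @compact_EVT_max Y R (fun s => s A) S S0 cS.
  by apply: continuous_subspaceT; exact: ptws_eval_continuous.
by rewrite inE => Ss smax; exists s => // t St; apply: smax; rewrite inE.
Qed.

Lemma compact_eval_bounded (S : set Y) A : compact S ->
  (forall s, S s -> lin_fun s) ->
  exists M : R, forall s, S s -> `|s A| <= M.
Proof.
move=> cS lS; have [S0|S0] := pselect (S !=set0); last first.
  by exists 0 => s Ss; exfalso; apply: S0; exists s.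
have [s1 _ h1] := compact_eval_max A cS S0.
have [s2 _ h2] := compact_eval_max (- A) cS S0.
exists (`|s1 A| + `|s2 (- A)|) => s Ss.
have := h1 s Ss; have := h2 s Ss; rewrite (lin_funN _ (lS s Ss)) => k2 k1.
have := ler_norm (s1 A); have := ler_norm (s2 (- A)).
have := normr_ge0 (s1 A); have := normr_ge0 (s2 (- A)).
by rewrite ler_norml => *; apply/andP; split; lra.
Qed.

Definition face (S : set Y) A : set Y := [set s | S s /\ forall t, S t -> t A <= s A].

Lemma face_compact S A : closed S -> compact S -> S !=set0 ->
  [/\ closed (face S A), compact (face S A) & face S A !=set0].
Proof.
move=> clS cS S0; have [s Ss smax] := compact_eval_max A cS S0.
have -> : face S A = S `&` [set t : Y | s A <= t A].
  apply/seteqP; split=> t [St h]; split=> //; first exact: h.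
  by move=> u /smax /le_trans; apply.
split; last by exists s; split => /=.
- exact: (@closedI Y _ _ clS (@halfspace_closed A (s A))).
- by apply: (@compact_closedI Y _ _ cS); exact: halfspace_closed.
Qed.

Lemma face_extremal S A s1 s2 (l : R) : 0 < l -> l < 1 -> S s1 -> S s2 ->
  face S A (fun B => l * s1 B + (1 - l) * s2 B) ->
  [/\ face S A s1, face S A s2 & s1 A = s2 A].
Proof.
move=> l0 l1 S1 S2 [_ h]; have h1 := h _ S1; have h2 := h _ S2.
have h1' : (1 - l) * s1 A <= (1 - l) * s2 A by lra.
have h2' : l * s2 A <= l * s1 A by lra.
rewrite ler_pM2l ?subr_gt0// in h1'; rewrite ler_pM2l// in h2'.
have e : s1 A = s2 A by apply/eqP; rewrite eq_le h1' h2'.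
have E : l * s1 A + (1 - l) * s2 A = s2 A by rewrite e; ring.
split=> //; split=> // t St; have := h t St; rewrite E // => h3.
by rewrite e.
Qed.

(** Filter of growing test lists and shrinking radii; near-covering compactness along it yields one
    list and one radius valid on a whole compact set. *)
Definition refinement : set_system (seq X * R) :=
  [set Q | exists (As0 : seq X) (e0 : R), 0 < e0 /\ forall (As : seq X) (e : R),
     {subset As0 <= As} -> 0 < e -> e <= e0 -> Q (As, e)].

Global Instance refinement_filter : Filter refinement.
Proof.
split=> [|Q Q' [As [e [e0 h]]] [As' [e' [e'0 h']]]|Q Q' QQ' [As [e [e0 h]]]].
- by exists [::], 1.
- exists (As ++ As'), (Num.min e e'); split; first by rewrite lt_min e0.
  move=> Bs r sub r0; rewrite le_min => /andP[re re']; split.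
    by apply: h => // A AAs; apply: sub; rewrite mem_cat AAs.
  by apply: h' => // A AAs; apply: sub; rewrite mem_cat AAs orbT.
- by exists As, e; split => // Bs r sub r0 re; apply: QQ'; exact: h.
Qed.

Lemma compact_far (C : set Y) (z : X -> R) : compact C -> ~ C z ->
  exists (As : seq X) (e : R), 0 < e /\
    forall s, C s -> exists2 A, A \in As & e <= `|s A - z A|.
Proof.
move=> /compact_near_coveringP cC Cz.
have [|As [e [e0 h]]] := cC _ refinement
    (fun (p : seq X * R) s => exists2 A, A \in p.1 & p.2 <= `|s A - z A|) _.
  move=> s Cs.
  have [A sA] : exists A, s A != z A.
    apply: contrapT => none; apply: Cz; suff -> : z = s by [].
    by apply/funext => A; apply: contrapT => /eqP h; apply: none; exists A; rewrite eq_sym.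
  have r0 : 0 < `|s A - z A| / 2 by rewrite divr_gt0// normr_gt0 subr_eq0.
  set r := `|s A - z A| / 2 in r0.
  exists ([set t : Y | `|t A - s A| < r],
          [set p : seq X * R | A \in p.1 /\ p.2 <= r]); first split => /=.
  + exact: ptws_ball_nbhs.
  + exists [:: A], r; split=> // As e sub e0 er; split=> //.
    by apply: sub; rewrite mem_head.
  move=> [t [As e]] /= [ts [AAs er]]; exists A => //.
  have := ler_distD (t A) (s A) (z A); rewrite (distrC (s A) (t A)).
  have : `|s A - z A| = r + r by rewrite /r; lra.
  lra.
exists As, e; split=> // s Cs; exact: (h As e).
Qed.

Lemma lin_fun_sum s (c : X -> R) (As : seq X) : lin_fun s ->
  s (\sum_(A <- As) c A *: A) = \sum_(A <- As) c A * s A.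
Proof.
move=> ls; elim: As => [|A As IH]; first by rewrite !big_nil lin_fun0.
by rewrite !big_cons ls IH.
Qed.

(* The direction is [z - s0] on finitely many test vectors, for [s0] an almost
   nearest point of [C] to [z]. *)
Lemma compact_convex_separation (C : set Y) (z : X -> R) :
  compact C -> convex_fset C -> (forall s, C s -> lin_fun s) -> lin_fun z -> ~ C z ->
  exists A (b : R), b < z A /\ forall s, C s -> s A <= b.
Proof.
move=> cC vC lC lz Cz.
have [C0|C0] := pselect (C !=set0); last first.
  exists 0, (-1); rewrite lin_fun0//; split; first lra.
  by move=> s Cs; exfalso; apply: C0; exists s.
have [As [e [e0 far]]] := compact_far cC Cz.
pose D s : R := \sum_(A <- As) (z A - s A) ^+ 2.
have [N N0 hN] : exists2 N : R, 0 < N & forall s t, C s -> C t ->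
    \sum_(A <- As) (s A - t A) ^+ 2 <= N.
  elim: (As) => [|A Bs [N N0 IH]].
    by exists 1 => // s t _ _; rewrite big_nil ler01.
  have [M hM] := compact_eval_bounded A cC lC.
  exists (4 * M ^+ 2 + N) => [|s t Cs Ct].
    by apply: ltr_wpDl => //; rewrite mulr_ge0// sqr_ge0.
  rewrite big_cons; apply: lerD; last exact: IH.
  have := hM s Cs; have := hM t Ct; rewrite !ler_norml => /andP[a1 a2] /andP[a3 a4].
  nra.
have S0 : [set D s | s in C] !=set0 by have [s Cs] := C0; exists (D s), s.
have lD : lbound [set D s | s in C] (e ^+ 2).
  move=> _ [s Cs <-]; have [A AAs eA] := far s Cs.
  rewrite /D (big_rem A)//=; apply: (@le_trans _ _ ((z A - s A) ^+ 2)).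
    by rewrite -[leRHS](real_normK (num_real _)) distrC; nra.
  by rewrite lerDl; apply: sumr_ge0 => *; exact: sqr_ge0.
pose d := inf [set D s | s in C].
have d0 : 0 < d by apply: lt_le_trans (lb_le_inf S0 lD); exact: exprn_gt0.
have Dd s : C s -> d <= D s by move=> Cs; apply: ge_inf; [exists (e ^+ 2)|exists s].
(* Step from [s0] towards [s], with [u ^+ 2 * N <= u * d / 2]. Comparing [D] at both ends, with [s0]
   optimal up to [u * d / 2], gives [I <= d / 2], whereas [z A - s0 A = D s0 >= d]. *)
pose u := d / (2 * N + d).
have Nd : 0 < 2 * N + d by lra.
have u0 : 0 < u by rewrite /u divr_gt0.
have u1 : u <= 1 by rewrite /u ler_pdivrMr// mul1r; lra.
have uE : u * (2 * N + d) = d by rewrite /u divfK// gt_eqF.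
have du : d < d + u * d / 2 by rewrite ltrDl divr_gt0// mulr_gt0.
have [_ [s0 Cs0 <-] Ds0] := inf_lt S0 du.
pose A := \sum_(B <- As) (z B - s0 B) *: B.
exists A, (z A - d / 2); split=> [|s Cs]; first by rewrite ltrBlDr ltrDl divr_gt0.
pose I := \sum_(B <- As) (z B - s0 B) * (s B - s0 B).
have sA : s A = s0 A + I.
  rewrite /A !lin_fun_sum; [|exact: lC|exact: lC].
  by rewrite /I -big_split; apply: eq_bigr => B _ /=; ring.
have zA : z A = s0 A + D s0.
  rewrite /A !lin_fun_sum//; last exact: lC.
  by rewrite /D -big_split; apply: eq_bigr => B _ /=; ring.
have := Dd _ Cs0; have := Dd _ (vC _ _ u Cs Cs0 (ltW u0) u1).
have -> : D (fun B => u * s B + (1 - u) * s0 B) =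
    D s0 - 2 * u * I + u ^+ 2 * \sum_(B <- As) (s B - s0 B) ^+ 2.
  rewrite /D /I !mulr_sumr -sumrB -big_split; apply: eq_bigr => B _ /=; ring.
have := hN s s0 Cs Cs0; set J := \sum_(_ <- _) _ => JN h1 h2.
have JN' : u ^+ 2 * J <= u ^+ 2 * N by rewrite ler_wpM2l ?sqr_ge0.
suff : I <= d / 2 by rewrite sA zA; lra.
rewrite -(ler_pM2l u0).
have : u ^+ 2 * N <= u * d / 2.
  have ud0 : 0 <= u * d by rewrite mulr_ge0// ltW.
  have : u * (2 * u * N) <= u * d by rewrite ler_pM2l//; lra.
  by rewrite expr2; lra.
lra.
Qed.

End PointwiseTopology.

(** * Compact convex sets of positive functionals *)

Section CompactConvex.
Context (R : realType) (X : tvsType R) (P : set X) (A1 A2 : X) (W : set X).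
Hypothesis W0 : nbhs (0 : X) W.
Hypothesis WA : W `<=` order_interval P A1 A2.
Local Notation Y := (ptws_functions R X).
Implicit Types (s t : X -> R) (A : X) (F : set (X -> R)).

Definition approximable (S : set (X -> R)) s : Prop :=
  forall (As : seq X) (e : R), 0 < e ->
    exists2 t, S t & forall A, A \in As -> `|t A - s A| < e.

Lemma approximable_lin_pos S s : S `<=` lin_pos P -> approximable S s -> lin_pos P s.
Proof.
move=> SP aS; split=> [a x y|A PA].
  apply/eqP; rewrite -subr_eq0 -normr_le0; apply/ler_addgt0Pr => e e0.
  have a0 := normr_ge0 a.
  have C0 : 0 < 2 + `|a| by lra.
  have [t St ts] := aS [:: a *: x + y; x; y] (e / (2 + `|a|)) (divr_gt0 e0 C0).
  have [lt _] := SP t St.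
  have h1 := ts (a *: x + y) ltac:(by rewrite inE eqxx).
  have h2 := ts x ltac:(by rewrite !inE eqxx orbT).
  have h3 := ts y ltac:(by rewrite !inE eqxx !orbT).
  rewrite lt in h1; set d := e / _ in h1 h2 h3.
  have -> : s (a *: x + y) - (a * s x + s y) =
    - (a * t x + t y - s (a *: x + y)) + (a * (t x - s x) + (t y - s y)) by ring.
  apply: le_trans (ler_normD _ _) _; rewrite normrN.
  have h4 := ler_normD (a * (t x - s x)) (t y - s y).
  have h5 : `|a * (t x - s x)| <= `|a| * d by rewrite normrM ler_wpM2l// ltW.
  have : d * (2 + `|a|) = e by rewrite /d divfK// gt_eqF.
  lra.
apply/ler_addgt0Pr => e e0; have [t St ts] := aS [:: A] e e0.
have := (SP t St).2 A PA; have := ts A (mem_head _ _).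
by rewrite ltr_norml => /andP[]; lra.
Qed.

(** Banach-Alaoglu for the positive cone: a closed subset of a product of segments, because
    pointwise limits stay linear and positive. *)
Lemma pos_ball_compact (M : R) :
  compact ([set s | lin_pos P s /\ enorm A1 A2 s <= M] : set Y).
Proof.
have /choice[u hu] A : exists u : R, 0 < u /\ forall s, lin_pos P s ->
    `|s A| <= u * enorm A1 A2 s.
  by have [u u0 hu] := lin_pos_bound_scaled W0 WA A; exists u.
pose box := [set f : Y | forall A, `[- (u A * M), u A * M]%classic (f A)].
have cbox : compact box.
  apply: (@tychonoff X (fun _ => (R : topologicalType))
    (fun A => `[- (u A * M), u A * M]%classic)) => A.
  exact: segment_compact.
apply: (subclosed_compact _ cbox) => [|s [ps sM] A]; last first.
  have : `|s A| <= u A * M.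
    by apply: le_trans ((hu A).2 s ps) _; rewrite ler_pM2l// (hu A).1.
  by rewrite ler_norml /= in_itv.
apply: ptws_closed => s h; split.
  by apply: approximable_lin_pos h => t [].
apply/ler_addgt0Pr => e e0; have e2 : 0 < e / 2 by rewrite divr_gt0.
have [t [_ tM] ts] := h [:: A1; A2] _ e2.
have h1 := ts A1 (mem_head _ _).
have h2 := ts A2 ltac:(by rewrite !inE eqxx orbT).
move: tM; rewrite /enorm.
have := ler_distD (t A1) (s A1) 0; have := ler_distD (t A2) (s A2) 0.
rewrite !subr0 (distrC (s A1)) (distrC (s A2)); lra.
Qed.

(** [wclosed] concerns limits in the dual; a pointwise limit of positive functionals is there
    automatically. *)
Lemma wclosed_closed F : F `<=` lin_pos P -> wclosed F -> closed (F : set Y).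
Proof.
move=> FP [_ wF]; apply: ptws_closed => s h; apply: wF; split=> //.
by have /(dual_posE W0 WA)[] := approximable_lin_pos FP h.
Qed.

Lemma wclosed_compact F (M : R) : F `<=` lin_pos P ->
  (forall f, F f -> enorm A1 A2 f <= M) -> wclosed F -> compact (F : set Y).
Proof.
move=> FP FM wF; apply: (subclosed_compact _ (@pos_ball_compact M)).
  exact: wclosed_closed wF.
by move=> f Ff; split; [exact: FP|exact: FM].
Qed.

(* Maximize successively along [A], [y 0], [y 1], and so on: the nested faces
   shrink to a single point because [y] separates positive functionals. *)
Lemma face_has_extreme F (y : nat -> X) A :
  (forall s t, lin_pos P s -> lin_pos P t -> (forall n, s (y n) = t (y n)) -> s = t) ->
  F `<=` lin_pos P -> closed (F : set Y) -> compact (F : set Y) -> F !=set0 ->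
  exists2 p, extreme_points F p & forall s, F s -> s A <= p A.
Proof.
move=> ysep FP clF cF F0.
pose Fs := fix Fs n : set Y := if n is k.+1 then face (Fs k) (y k) else face (F : set Y) A.
have FsP n : [/\ closed (Fs n), compact (Fs n) & Fs n !=set0].
  by elim: n => [|n [h1 h2 h3]]; apply: face_compact.
have Fs_sub m n : (m <= n)%N -> Fs n `<=` Fs m.
  elim: n => [|n IH]; first by rewrite leqn0 => /eqP ->.
  rewrite leq_eqVlt => /orP[/eqP -> //|]; rewrite ltnS => mn s [/= Fss _].
  exact: IH.
have /choice[u hu] n : exists s, Fs n s by have [_ _ []] := FsP n => s ?; exists s.
have FsF n : Fs n `<=` F by move=> s /(Fs_sub 0%N n (leq0n _))[].
(* A cluster point of points picked in successive faces lies in all of them, the faces being closed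
   and nested. *)
have [|p [Fp clp]] := cF (u @ \oo) _.
  by exists 0%N => // n _; exact: (FsF n).
have Fsp k : Fs k p.
  have [clk _ _] := FsP k; apply: clk => B pB; apply: clp => //.
  by exists k => // n /= kn; exact: (Fs_sub k n).
exists p; last by have [] := Fsp 0%N.
split=> // s1 s2 l F1 F2 l0 l1 E.
have key n : Fs n s1 /\ Fs n s2.
  elim: n => [|n [h1 h2]].
    by have := Fsp 0%N; rewrite E => /(face_extremal l0 l1 F1 F2)[].
  by have := Fsp n.+1; rewrite E => /(face_extremal l0 l1 h1 h2)[].
apply: ysep => [||n]; [exact: FP|exact: FP|].
have [h1 h2] := key n.
by have := Fsp n.+1; rewrite E => /(face_extremal l0 l1 h1 h2)[].
Qed.

(** The convex hull of the union for nonempty convex sets; it is empty if either set is, whence the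
    case splits in [extreme_hull]. *)
Definition segment_join (C D : set (X -> R)) : set (X -> R) :=
  [set r | exists s t (l : R), [/\ C s, D t, 0 <= l <= 1 &
     r = (fun A => l * s A + (1 - l) * t A)]].

Lemma segment_join_compact C D : compact (C : set Y) -> compact (D : set Y) ->
  compact (segment_join C D : set Y).
Proof.
move=> cC cD.
pose f (q : R * (Y * Y)) : Y := fun A => q.1 * q.2.1 A + (1 - q.1) * q.2.2 A.
have -> : segment_join C D = f @` (`[0, 1]%classic `*` (C `*` D)).
  apply/seteqP; split=> [r [s [t [l [Cs Dt l01 ->]]]]|_ [[l [s t]] /= [l01 [Cs Dt]] <-]].
    by exists (l, (s, t)) => //; split => //=; rewrite in_itv.
  by exists s, t, l; split=> //; move: l01; rewrite in_itv.
apply: continuous_compact; last first.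
  by apply: compact_setX; [exact: segment_compact|exact: compact_setX].
apply: continuous_subspaceT => q.
apply/(@pointwise_cvgP X R) => A.
have c1 : (fun q : R * (Y * Y) => q.1) @ q --> q.1 by exact: cvg_fst.
have cs : (fun q : R * (Y * Y) => q.2.1 A) @ q --> q.2.1 A.
  apply: (@continuous_comp _ _ _ (fun q : R * (Y * Y) => q.2.1) (fun s : Y => s A)).
    apply: (@continuous_comp _ _ _ (fun q : R * (Y * Y) => q.2) fst).
      exact: cvg_snd.
    exact: cvg_fst.
  exact: (@ptws_eval_continuous R X A _).
have ct : (fun q : R * (Y * Y) => q.2.2 A) @ q --> q.2.2 A.
  apply: (@continuous_comp _ _ _ (fun q : R * (Y * Y) => q.2.2) (fun s : Y => s A)).
    apply: (@continuous_comp _ _ _ (fun q : R * (Y * Y) => q.2) snd).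
      exact: cvg_snd.
    exact: cvg_snd.
  exact: (@ptws_eval_continuous R X A _).
have h : (fun q : R * (Y * Y) => q.1 * q.2.1 A + (1 - q.1) * q.2.2 A) @ q -->
    q.1 * q.2.1 A + (1 - q.1) * q.2.2 A.
  by apply: cvgD; apply: cvgM => //; apply: cvgB c1; exact: cvg_cst.
exact: h.
Qed.

Lemma segment_join_convex C D : convex_fset C -> convex_fset D ->
  convex_fset (segment_join C D).
Proof.
move=> vC vD _ _ m [s [t [l [Cs Dt /andP[l0 l1] ->]]]]
  [s' [t' [l' [Cs' Dt' /andP[l'0 l'1] ->]]]] m0 m1.
(* Normalizes the weights inside one set; the identity is kept multiplied by [a + b] to cover total
   weight 0. *)
have mix E (w w' : X -> R) (a b : R) : convex_fset E -> E w -> E w' -> 0 <= a -> 0 <= b ->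
    exists2 v, E v & forall A, (a + b) * v A = a * w A + b * w' A.
  move=> vE Ew Ew' a0 b0; have [ab|ab] := eqVneq (a + b) 0.
    have [a_0 b_0] : a = 0 /\ b = 0 by split; lra.
    by exists w => // A; rewrite a_0 b_0; ring.
  have ab0 : 0 < a + b by rewrite lt_neqAle eq_sym ab addr_ge0.
  exists (fun A => a / (a + b) * w A + (1 - a / (a + b)) * w' A).
    apply: vE => //; first by rewrite divr_ge0// ltW.
    by rewrite ler_pdivrMr// mul1r lerDl.
  by move=> A; field.
have n0 : 0 <= 1 - m by lra.
have [v Cv hv] := mix C s s' (m * l) ((1 - m) * l') vC Cs Cs'
  ltac:(exact: mulr_ge0) ltac:(exact: mulr_ge0).
have [w Dw hw] := mix D t t' (m * (1 - l)) ((1 - m) * (1 - l')) vD Dt Dt'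
  ltac:(by rewrite mulr_ge0// subr_ge0) ltac:(by rewrite mulr_ge0// subr_ge0).
exists v, w, (m * l + (1 - m) * l'); split=> //.
  by apply/andP; split; nra.
apply/funext => A; rewrite hv.
have -> : 1 - (m * l + (1 - m) * l') = m * (1 - l) + (1 - m) * (1 - l') by ring.
by rewrite hw; ring.
Qed.

(* The part of a compact convex set away from an extreme point [p], in finitely
   many directions, stays in a compact convex set avoiding [p]. *)
Lemma extreme_hull F p (d : R) (Bs : seq X) : convex_fset F -> compact (F : set Y) ->
  extreme_points F p -> 0 < d ->
  exists C : set (X -> R), [/\ compact (C : set Y), convex_fset C, C `<=` F, ~ C p &
    forall s B, B \in Bs -> F s -> p B + d <= s B -> C s].
Proof.
move=> vF cF [Fp pext] d0; elim: Bs => [|B Bs [C [cC vC CF Cp hC]]].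
  by exists set0; split=> //; exact: compact0.
pose D : set (X -> R) := F `&` [set s | p B + d <= s B].
have cD : compact (D : set Y).
  by apply: (@compact_closedI Y) => //; exact: halfspace_closed.
have vD : convex_fset D.
  move=> s t l [Fs /= sB] [Ft /= tB] l0 l1; split; first exact: vF.
  by rewrite /=; nra.
have Dp : ~ D p by case=> _ /=; lra.
have [[s0 Cs0]|C0] := pselect (C !=set0); last first.
  exists D; split=> // [s []//|s A]; rewrite inE => /orP[/eqP ->|/hC h Fs /(h s Fs) Cs].
    by move=> Fs sB; split.
  by exfalso; apply: C0; exists s.
have [[t0 Dt0]|D0] := pselect (D !=set0); last first.
  exists C; split=> // s A; rewrite inE => /orP[/eqP ->|]; last exact: hC.
  by move=> Fs sB; exfalso; apply: D0; exists s; split.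
exists (segment_join C D); split.
- exact: segment_join_compact.
- exact: segment_join_convex.
- by move=> _ [s [t [l [/CF Fs [Ft _] /andP[l0 l1] ->]]]]; exact: vF.
(* If [p] were on a joining segment, it would be an endpoint, or equal to both by extremality;
   neither [C] nor [D] contains it. *)
- move=> [s [t [l [Cs Dt /andP[l0 l1] E]]]].
  have [l_0|l_n0] := eqVneq l 0.
    by apply: Dp; suff -> : p = t by []; rewrite E l_0; apply/funext => A; ring.
  have [l_1|l_n1] := eqVneq l 1.
    by apply: Cp; suff -> : p = s by []; rewrite E l_1; apply/funext => A; ring.
  have l_gt0 : 0 < l by rewrite lt_neqAle eq_sym l_n0.
  have l_lt1 : l < 1 by rewrite lt_neqAle l_n1.
  have st := pext s t l (CF s Cs) Dt.1 l_gt0 l_lt1 E.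
  apply: Cp; suff -> : p = s by [].
  by rewrite E -st; apply/funext => A; ring.
- move=> s A; rewrite inE => /orP[/eqP -> Fs sB|/hC h Fs /(h s Fs) Cs].
    exists s0, s, 0; split=> //; first by rewrite lexx ler01.
    by apply/funext => z; ring.
  exists s, t0, 1; split=> //; first by rewrite lexx ler01.
  by apply/funext => z; ring.
Qed.

(** This is [h_F(A + B) < h_F(A) + s(B) + d] for [B] in [Bs], [F] being compact: [s0] stands for a
    maximizer at [A], [eta] for the strictness. *)
Definition peaked F (Bs : seq X) (d : R) s : Prop :=
  exists A s0 (eta : R), [/\ F s0, 0 < eta & forall t B, F t -> B \in Bs ->
    t A + t B + eta <= s0 A + s B + d].

(** A large multiple of a vector separating [p] from the hull [C] penalizes all of [C]; outside [C],
    values at [Bs] exceed those of [p] by less than [d / 2]. *)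
Lemma extreme_peaked F p (Bs : seq X) (d : R) : F `<=` lin_pos P ->
  convex_fset F -> compact (F : set Y) -> extreme_points F p -> 0 < d ->
  peaked F Bs d p.
Proof.
move=> FP vF cF ep d0; have d2 : 0 < d / 2 by rewrite divr_gt0.
have [C [cC vC CF Cp hC]] := extreme_hull Bs vF cF ep d2.
have [Fp _] := ep.
have lF s : F s -> lin_fun s by move=> /FP[].
have [A [b [bp Cb]]] := compact_convex_separation cC vC (fun s Cs => lF s (CF s Cs)) (lF p Fp) Cp.
have [s0 Fs0 s0max] := compact_eval_max A cF (ex_intro _ p Fp).
have [M M0 hM] : exists2 M : R, 0 <= M & forall s B, F s -> B \in Bs -> s B - p B <= M.
  elim: (Bs) => [|B Bs' [M M0 IH]]; first by exists 0.
  have [M' hM'] := compact_eval_bounded B cF lF.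
  have M'0 : 0 <= M' by apply: le_trans (hM' p Fp).
  exists (M + 2 * M') => [|s B' Fs]; first lra.
  rewrite inE => /orP[/eqP ->|/(IH s B' Fs)]; last lra.
  have := hM' s Fs; have := hM' p Fp; rewrite !ler_norml => /andP[? ?] /andP[? ?]; lra.
have Hb : 0 < s0 A - b by have := s0max p Fp; lra.
(* On [C] the loss [l * (s0 A - b) = M] pays for the largest possible excess of [s B] over [p B]. *)
pose l := M / (s0 A - b).
have l0 : 0 <= l by rewrite /l divr_ge0// ltW.
have lE : l * (s0 A - b) = M by rewrite /l divfK// gt_eqF.
exists (l *: A), s0, (d / 2); split=> // t B Ft BBs.
rewrite (lin_funZ _ _ (lF t Ft)) (lin_funZ _ _ (lF s0 Fs0)).
have [tB|tB] := lerP (p B + d / 2) (t B).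
  have : l * t A <= l * b by rewrite ler_wpM2l//; apply/Cb/(hC t B).
  by have := hM t B Ft BBs; lra.
have : l * t A <= l * s0 A by rewrite ler_wpM2l// s0max.
lra.
Qed.

End CompactConvex.

(** * The G_delta property *)

Section Gdelta.
Context (R : realType) (X : tvsType R) (P : set X) (A1 A2 : X) (W : set X).
Hypothesis W0 : nbhs (0 : X) W.
Hypothesis WA : W `<=` order_interval P A1 A2.
Local Notation Y := (ptws_functions R X).
Implicit Types (s t : X -> R) (A : X) (F G : set (X -> R)).

Lemma CU_pos_compact F : CU_pos P F -> [/\ F !=set0, convex_fset F, wclosed F,
  F `<=` lin_pos P & exists M : R, forall f, F f -> enorm A1 A2 f <= M].
Proof.
move=> [U U0 [[F0 [vF [wF FU]]] FP]].
have FP' : F `<=` lin_pos P by move=> f /FP /(dual_posE W0 WA).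
have [M hM] := polar_enorm_bounded A1 A2 U0.
by split=> //; exists M => f /FU; exact: hM.
Qed.

Definition peaked_sets (Bs : seq X) (d : R) : set (set (X -> R)) :=
  [set F | CU_pos P F /\ forall s, F s -> peaked F Bs d s].

Lemma hball_sub (As Bs : seq X) (d e : R) F G : {subset As <= Bs} -> d <= e ->
  hball Bs d F G -> hball As e F G.
Proof.
by move=> AB de h A /AB /h /lt_le_trans; apply; rewrite lee_fin.
Qed.

(* The positive functionals in a ball containing all sets near [F] are covered
   by the complement of [F] and by the functionals at which [F] is peaked;
   compactness of the ball makes the neighbourhoods uniform. *)
Lemma peaked_sets_open Bs (d : R) : hopen_in (CU_pos P) (peaked_sets Bs d).
Proof.
split=> [F [] //|F [CF pF]].
have [F0 vF wF FP [M FM]] := CU_pos_compact CF.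
have cF : compact (F : set Y) := wclosed_compact W0 WA FP FM wF.
have lF s : F s -> lin_fun s by move=> /FP[].
(* Members of sets near [F] are within 1 of possibly different points of [F] at [A1] and [A2], so
   each value is at most [M + 1] in modulus. *)
have /compact_near_coveringP cB := pos_ball_compact W0 WA (M := 2 * M + 2).
have [|As [e [e0 h]]] := cB _ (@refinement R X) (fun p s => forall G, CU_pos P G ->
    hball p.1 p.2 F G -> G s -> peaked G Bs d s) _.
  move=> z [pz _]; have [Fz|Fz] := pselect (F z).
    have [A [s0 [eta [Fs0 eta0 hA]]]] := pF z Fz.
    (* Three errors below [eta / 4], at [A], at [A + B] and in [z B], leave a margin [eta / 4] for
       [G]. *)
    have eta4 : 0 < eta / 4 by rewrite divr_gt0.
    exists ([set t : Y | forall B, B \in Bs -> `|t B - z B| < eta / 4],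
      [set p : seq X * R | {subset A :: [seq A + B | B <- Bs] <= p.1} /\ p.2 <= eta / 4]).
      split=> /=; first exact: ptws_balls_nbhs.
      by exists (A :: [seq A + B | B <- Bs]), (eta / 4).
    move=> [t [As e]] /= [tz [sub ele]] G CG /(hball_sub sub ele) hG Gt.
    have [_ _ _ GP _] := CU_pos_compact CG.
    have [/(_ _ Fs0)[s0' Gs0' s0s0'] _] := dH_lt_approx (hG A (mem_head _ _)).
    exists A, s0', (eta / 4); split=> // u B Gu BBs.
    have ABin : A + B \in A :: [seq A + B | B <- Bs].
      by rewrite inE (map_f (fun B => A + B)) ?orbT.
    have [_ /(_ u Gu)[s Fs su]] := dH_lt_approx (hG _ ABin).
    have := hA s B Fs BBs; have := tz B BBs.
    move: su; rewrite (lin_funD _ _ (lF s Fs)) (lin_funD _ _ (GP u Gu).1).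
    move: s0s0'; rewrite !ltr_norml => /andP[? ?] /andP[? ?] /andP[? ?]; lra.
  (* For [z] outside [F] the claim is vacuous: sets near [F] have no member near [z]. *)
  have [A [b [bz Fb]]] := compact_convex_separation cF vF lF pz.1 Fz.
  have r0 : 0 < (z A - b) / 2 by rewrite divr_gt0// subr_gt0.
  exists ([set t : Y | `|t A - z A| < (z A - b) / 2],
    [set p : seq X * R | {subset [:: A] <= p.1} /\ p.2 <= (z A - b) / 2]).
    split=> /=; first exact: ptws_ball_nbhs.
    by exists [:: A], ((z A - b) / 2).
  move=> [t [As e]] /= [tz [sub ele]] G CG /(hball_sub sub ele) hG Gt.
  have [_ /(_ t Gt)[s Fs st]] := dH_lt_approx (hG A (mem_head _ _)).
  have := Fb s Fs; move: tz st; rewrite !ltr_norml => /andP[? ?] /andP[? ?]; lra.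
exists (A1 :: A2 :: As), (Num.min e 1); split; first by rewrite lt_min e0 ltr01.
move=> G CG hG; split=> // t Gt.
have [_ _ _ GP _] := CU_pos_compact CG.
have near1 A : A \in A1 :: A2 :: As -> exists2 s, F s & `|s A - t A| < 1.
  move=> AAs; have hA : hball [:: A] 1 F G.
    apply: hball_sub hG; last by rewrite ge_min lexx orbT.
    by move=> B; rewrite inE => /eqP ->.
  by have [_ /(_ t Gt)] := dH_lt_approx (hA A (mem_head _ _)).
apply: (h (A1 :: A2 :: As) (Num.min e 1)) => //=.
- by move=> A AAs; rewrite !inE AAs !orbT.
- by rewrite lt_min e0 ltr01.
- by rewrite ge_min lexx.
split; first exact: GP.
have [s1 Fs1 h1] := near1 A1 ltac:(by rewrite inE eqxx).
have [s2 Fs2 h2] := near1 A2 ltac:(by rewrite !inE eqxx orbT).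
have := FM s1 Fs1; have := FM s2 Fs2; rewrite /enorm.
have := normr_ge0 (s1 A2); have := normr_ge0 (s2 A1).
have := ler_distD (s1 A1) (t A1) 0; have := ler_distD (s2 A2) (t A2) 0.
rewrite !subr0 (distrC (t A1)) (distrC (t A2)); lra.
Qed.

(** Forward, peakedness passes from an extreme point to the points it approximates. Backward, an
    extreme point [p] maximizing [A] satisfies [p B < s B + d] for each tested [B]. *)
Lemma Dpos_bigcap (y : nat -> X) : dense_range y ->
  Dpos P = \bigcap_n peaked_sets [seq y j | j <- iota 0 n] n.+1%:R^-1.
Proof.
move=> dy; apply/seteqP; split=> [F [[U U0 [[F0 [vF [wF FU]]] FE]] CF] n _|F hF].
  split=> // s Fs; have [_ _ _ FP [M FM]] := CU_pos_compact CF.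
  have cF : compact (F : set Y) := wclosed_compact W0 WA FP FM wF.
  have i0 : 0 < (n.+1%:R^-1 : R) by rewrite invr_gt0.
  move: (n.+1%:R^-1) i0 => i i0; have d0 : 0 < i / 2 by rewrite divr_gt0.
  have : wclosure (extreme_points F) s by rewrite -FE.
  move=> -[_ /(_ [seq y j | j <- iota 0 n] _ d0)[p ep ps]].
  have [A [s0 [eta [Fs0 eta0 h]]]] :=
    extreme_peaked [seq y j | j <- iota 0 n] FP vF cF ep d0.
  exists A, s0, eta; split=> // t B Ft BBs.
  have := h t B Ft BBs; have := ps B BBs; rewrite ltr_norml => /andP[? ?]; lra.
have CF : CU_pos P F by have [] := hF 0%N I.
have [F0 vF wF FP [M FM]] := CU_pos_compact CF.
have cF : compact (F : set Y) := wclosed_compact W0 WA FP FM wF.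
have clF : closed (F : set Y) := wclosed_closed W0 WA FP wF.
split=> //; have [U U0 [FU FD]] := CF; exists U => //; split=> //.
apply/seteqP; split=> [s Fs|s [ds h]]; last first.
  apply: wF.2; split=> // As e e0; have [t [Ft _] ts] := h As e e0.
  by exists t.
split=> [|As e e0]; first exact: wF.1.
have M0 : 0 <= M by apply: le_trans (FM s Fs); exact: enorm_ge0.
have M1 : 0 < M + 1 by lra.
pose r := e / 4 / (M + 1).
have r0 : 0 < r by rewrite /r !divr_gt0.
have rM : r * M <= e / 4.
  by rewrite /r mulrAC ler_pdivrMr// ler_wpM2l; lra.
have approx A : exists k, forall t, F t -> `|t (y k) - t A| <= e / 4.
  have [k hk] := dense_seq_approx W0 WA dy A r0.
  exists k => t Ft; apply: le_trans (hk t (FP t Ft)) _; apply: le_trans rM.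
  by rewrite ler_pM2l// FM.
(* Both [A] and [- A] are approximated, since peakedness bounds [p - s] from one side only. *)
have [N hN] : exists N, forall A, A \in As ->
    (exists2 k, (k < N)%N & forall t, F t -> `|t (y k) - t A| <= e / 4) /\
    (exists2 k, (k < N)%N & forall t, F t -> `|t (y k) - t (- A)| <= e / 4).
  elim: As => [|A As [N IH]]; first by exists 0%N.
  have [k hk] := approx A; have [k' hk'] := approx (- A).
  exists (maxn N (maxn k k').+1) => B; rewrite inE => /orP[/eqP ->|/IH[[i iN hi] [j jN hj]]].
    split; [exists k|exists k'] => //; rewrite leq_max ltnS.
      by rewrite leq_maxl orbT.
    by rewrite leq_maxr orbT.
  by split; [exists i|exists j] => //; rewrite leq_max ?iN ?jN.
pose n := (N + Num.truncn (4 / e))%N.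
have ne : n.+1%:R^-1 < e / 4.
  have h1 : 4 / e < n.+1%:R.
    apply: lt_le_trans (truncnS_gt _) _.
    by rewrite ler_nat ltnS leq_addl.
  by rewrite -(invf_div 4 e) ltf_pV2 ?posrE ?divr_gt0//.
have [_ /(_ s Fs)[A [s0 [eta [Fs0 eta0 h]]]]] := hF n I.
move: (n.+1%:R^-1) ne h => i ie h.
have [p ep pmax] := face_has_extreme A (dense_seq_separates W0 WA dy) FP clF cF F0.
exists p => // B BAs; have Fp := ep.1.
have ylt k : (k < N)%N -> y k \in [seq y j | j <- iota 0 n].
  by move=> kN; rewrite map_f// mem_iota /= (leq_trans kN)// leq_addr.
have [[k kN hk] [k' k'N hk']] := hN B BAs.
have := h p _ Fp (ylt k kN); have := h p _ Fp (ylt k' k'N).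
have := pmax s0 Fs0.
have := hk p Fp; have := hk s Fs; have := hk' p Fp; have := hk' s Fs.
have lF t : F t -> lin_fun t by move=> /FP[].
rewrite !(lin_funN _ (lF _ _))// !ler_norml => /andP[? ?] /andP[? ?] /andP[? ?] /andP[? ?] ? ? ?.
by rewrite ltr_norml; apply/andP; split; lra.
Qed.

Lemma Dpos_Gdelta : separable_space X -> hGdelta_in (CU_pos P) (Dpos P).
Proof.
move=> /separable_dense_seq[y dy]; rewrite (Dpos_bigcap dy).
exists (fun n => peaked_sets [seq y j | j <- iota 0 n] n.+1%:R^-1).
by split=> // n; exact: peaked_sets_open.
Qed.

End Gdelta.

Theorem theorem4p16 (R : realType) (X : tvsType R) (P : set X) :
  separable_space X ->
  completely_metrizable X ->
  convex_cone P ->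
  (forall U : set X, nbhs (0 : X) U ->
     exists A1 A2 : X, exists2 U' : set X, nbhs (0 : X) U' &
       U' `<=` order_interval P A1 A2 /\ order_interval P A1 A2 `<=` U) ->
  (exists2 U : set X, nbhs (0 : X) U & infinite_dim_cond U) ->
  hdense_in (CU_pos P) (Dpos P) /\ hGdelta_in (CU_pos P) (Dpos P).
Proof.
move=> sepX _ coneP order_nbhs [_ _ [sq [sq_dual sq_indep _]]].
(* The whole space as [U] supplies one fixed interval around 0. *)
have [A1 [A2 [W W0 [WA _]]]] := order_nbhs setT filterT.
split; first exact: (Dpos_dense coneP W0 WA order_nbhs sq_dual sq_indep sepX).
exact: (Dpos_Gdelta W0 WA sepX).
Qed.
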